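(* DTP restricted to instances whose query is nonrecursive and connected is in PTIME in data complexity (i.e., when the query is fixed), with numbers encoded in unary.
   Context: Temporal Datalog. Constants are partitioned into objects and integer time points; variables into object variables and time variables. A time term is a time point, a time variable, or an expression $t+k$ with $t$ a time variable and $k\in\mathbb{Z}$. Each predicate is either extensional (EDB) or intensional (IDB) and has an arity $n\ge0$, each position being of object sort or time sort; a predicate is rigid if all its positions are of object sort, and temporal if its last position is of time sort and all others are of object sort. An atom $P(t_1,\dots,t_n)$ has terms of the required sorts. A rule is $\bigwedge_i\alpha_i\to\alpha$ with $\alpha$ and all $\alpha_i$ rigid or temporal atoms, $\alpha$ IDB whenever the body is nonempty, and every head variable occurring in the body. A program is a finite set of rules. A fact is a ground rigid or temporal atom without $+$ (identified with the rule $\top\to\alpha$); a dataset is a finite set of EDB facts. Rules are read as universally quantified first-order sentences with $+$ interpreted as integer addition; $\Pi\models\alpha$ denotes entailment. A query is $Q=\langle P_Q,\Pi_Q\rangle$ with $\Pi_Q$ a program and $P_Q$ an IDB predicate of $\Pi_Q$; it is temporal if $P_Q$ is temporal. For a temporal query $Q$, dataset $D$ and time point $\tau$, $Q(D,\tau)$ is the set of tuples of objects $\vec o$ with $\Pi_Q\cup D\models P_Q(\vec o,\tau)$. A $\tau_{in}$-history is a dataset consisting of rigid facts and temporal facts with time argument $\le\tau_{in}$; a $\tau_{in}$-update is a dataset consisting of temporal facts with time argument $>\tau_{in}$. Definitive Time Point (DTP): an instance is $\langle Q,D,\tau_{in},\tau_{out}\rangle$ with $Q$ a temporal query, $D$ a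 $\tau_{in}$-history and $\tau_{out}\le\tau_{in}$; DTP holds for it iff $Q(D,\tau_{out})=Q(D\cup U,\tau_{out})$ for every $\tau_{in}$-update $U$. Predicate $P$ depends on $P'$ in $\Pi$ if some rule of $\Pi$ has $P$ in the head and $P'$ in the body; $\Pi$ (or a query with program $\Pi$) is nonrecursive if the graph of this dependency relation is acyclic. A rule is connected if it contains at most one time variable and, if a time variable occurs in the body, it also occurs in the head; a query is connected if all its rules are. *)

(* Defs.v *)
From Stdlib Require Import ZArith Relations.
From mathcomp Require Import all_boot.
From Stdlib Require Lists.List.

Set Implicit Arguments.
Unset Strict Implicit.
Unset Printing Implicit Defensive.

Definition obj := nat.

Inductive sort := SObj | STime.

(* A predicate: a name, the sorts of its positions (hence its arity) and
   whether it is extensional (EDB, pedb = true) or intensional (IDB). *)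
Record pred := Pred { pname : nat; psorts : seq sort; pedb : bool }.

(* Terms: object constant, object variable, time point, time term t + k
   (TVar v 0 is the plain time variable v). *)
Inductive term :=
| OConst of obj
| OVar of nat
| TConst of Z
| TVar of nat & Z.

Record atom := Atom { apred : pred; aargs : seq term }.

Record rule := Rule { rbody : seq atom; rhead : atom }.

Definition program := seq rule.

Definition is_obj_sort (s : sort) : bool := if s is SObj then true else false.

Definition term_has_sort (t : term) (s : sort) : bool :=
  match t, s with
  | OConst _, SObj | OVar _, SObj => true
  | TConst _, STime | TVar _ _, STime => true
  | _, _ => false
  end.

Definition rigid_pred (P : pred) : Prop := all is_obj_sort (psorts P).

Definition temporal_pred (P : pred) : Prop :=
  exists ss, psorts P = rcons ss STime /\ all is_obj_sort ss.

Definition wf_atom (a : atom) : Prop :=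
  all2 term_has_sort (aargs a) (psorts (apred a)).

Definition rigid_or_temporal_atom (a : atom) : Prop :=
  wf_atom a /\ (rigid_pred (apred a) \/ temporal_pred (apred a)).

Definition term_has_ovar (v : nat) (t : term) : Prop := t = OVar v.
Definition term_has_tvar (v : nat) (t : term) : Prop := exists k, t = TVar v k.

Definition atom_has_ovar v (a : atom) : Prop := List.Exists (term_has_ovar v) (aargs a).
Definition atom_has_tvar v (a : atom) : Prop := List.Exists (term_has_tvar v) (aargs a).

Definition body_has_ovar v (r : rule) : Prop := List.Exists (atom_has_ovar v) (rbody r).
Definition body_has_tvar v (r : rule) : Prop := List.Exists (atom_has_tvar v) (rbody r).

Definition rule_has_tvar v (r : rule) : Prop :=
  atom_has_tvar v (rhead r) \/ body_has_tvar v r.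

Definition wf_rule (r : rule) : Prop :=
  rigid_or_temporal_atom (rhead r) /\
  List.Forall rigid_or_temporal_atom (rbody r) /\
  (rbody r <> [::] -> pedb (apred (rhead r)) = false) /\
  (forall v, atom_has_ovar v (rhead r) -> body_has_ovar v r) /\
  (forall v, atom_has_tvar v (rhead r) -> body_has_tvar v r).

Definition wf_program (Pi : program) : Prop := List.Forall wf_rule Pi.

Definition ground_term (t : term) : Prop :=
  match t with OConst _ | TConst _ => True | _ => False end.

Definition is_fact (a : atom) : Prop :=
  rigid_or_temporal_atom a /\ List.Forall ground_term (aargs a).

Definition fact_rule (a : atom) : rule := Rule [::] a.

Definition dataset := seq atom.

Definition is_dataset (D : dataset) : Prop :=
  List.Forall (fun a => is_fact a /\ pedb (apred a) = true) D.

Definition history (tin : Z) (D : dataset) : Prop :=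
  is_dataset D /\
  List.Forall (fun a => rigid_pred (apred a) \/
     (temporal_pred (apred a) /\
      exists os z, aargs a = rcons os (TConst z) /\ (z <= tin)%Z)) D.

Definition update (tin : Z) (U : dataset) : Prop :=
  is_dataset U /\
  List.Forall (fun a => temporal_pred (apred a) /\
      exists os z, aargs a = rcons os (TConst z) /\ (tin < z)%Z) U.

Section Semantics.
Variable U : Type.
Variable c : obj -> U.
Variable I : pred -> seq (U + Z) -> Prop.

Definition eval_term (ov : nat -> U) (tv : nat -> Z) (t : term) : U + Z :=
  match t with
  | OConst o => inl (c o)
  | OVar v => inl (ov v)
  | TConst z => inr z
  | TVar v k => inr (tv v + k)%Z
  end.

Definition sat_atom ov tv (a : atom) : Prop :=
  I (apred a) (map (eval_term ov tv) (aargs a)).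

Definition sat_rule (r : rule) : Prop :=
  forall ov tv, List.Forall (sat_atom ov tv) (rbody r) -> sat_atom ov tv (rhead r).

Definition sat_program (Pi : program) : Prop := List.Forall sat_rule Pi.
End Semantics.

Definition entails (Pi : program) (alpha : atom) : Prop :=
  forall (U : Type) (c : obj -> U) (I : pred -> seq (U + Z) -> Prop),
    sat_program c I Pi -> forall ov tv, sat_atom c I ov tv alpha.

Definition with_data (Pi : program) (D : dataset) : program := Pi ++ map fact_rule D.

Record query := Query { qpred : pred; qprog : program }.

Definition pred_occurs (P : pred) (Pi : program) : Prop :=
  List.Exists (fun r => apred (rhead r) = P \/
                        List.Exists (fun b => apred b = P) (rbody r)) Pi.

Definition wf_query (Q : query) : Prop :=
  wf_program (qprog Q) /\ pedb (qpred Q) = false /\ pred_occurs (qpred Q) (qprog Q).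

Definition temporal_query (Q : query) : Prop := temporal_pred (qpred Q).

Definition answer (Q : query) (D : dataset) (tau : Z) (os : seq obj) : Prop :=
  size os = (size (psorts (qpred Q))).-1 /\
  entails (with_data (qprog Q) D) (Atom (qpred Q) (rcons (map OConst os) (TConst tau))).

Definition DTP (Q : query) (D : dataset) (tin tout : Z) : Prop :=
  forall Upd, update tin Upd ->
    forall os, answer Q D tout os <-> answer Q (D ++ Upd) tout os.

Definition depends (Pi : program) (P P' : pred) : Prop :=
  List.Exists (fun r => apred (rhead r) = P /\
                        List.Exists (fun b => apred b = P') (rbody r)) Pi.

Definition nonrecursive (Q : query) : Prop :=
  forall P, ~ clos_trans pred (depends (qprog Q)) P P.

Definition connected_rule (r : rule) : Prop :=
  (forall v w, rule_has_tvar v r -> rule_has_tvar w r -> v = w) /\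
  (forall v, body_has_tvar v r -> atom_has_tvar v (rhead r)).

Definition connected (Q : query) : Prop := List.Forall connected_rule (qprog Q).

Inductive sym := B0 | B1 | UnitS | NegS | EndS | SepS | HashS.

Fixpoint enc_pos (p : positive) : seq sym :=
  match p with
  | xI q => B1 :: enc_pos q
  | xO q => B0 :: enc_pos q
  | xH => [:: B1]
  end.

Definition enc_nat (n : nat) : seq sym :=
  match N.of_nat n with
  | N0 => [:: EndS]
  | Npos p => enc_pos p ++ [:: EndS]
  end.

Definition enc_int (z : Z) : seq sym :=
  (if (z <? 0)%Z then [:: NegS] else [::]) ++ nseq (Z.abs_nat z) UnitS ++ [:: EndS].

Definition enc_sort (s : sort) : sym := if s is SObj then B0 else B1.

Definition enc_pred (P : pred) : seq sym :=
  enc_nat (pname P) ++ map enc_sort (psorts P) ++ [:: EndS; if pedb P then B1 else B0].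

Definition enc_term (t : term) : seq sym :=
  match t with
  | OConst o => B0 :: enc_nat o
  | TConst z => B1 :: enc_int z
  | OVar v => UnitS :: enc_nat v
  | TVar v k => NegS :: enc_nat v ++ enc_int k
  end.

Definition enc_atom (a : atom) : seq sym :=
  enc_pred (apred a) ++ flatten (map enc_term (aargs a)) ++ [:: SepS].

Definition enc_dataset (D : dataset) : seq sym := flatten (map enc_atom D).

Definition enc_instance (x : dataset * Z * Z) : seq sym :=
  let: (D, tin, tout) := x in
  enc_dataset D ++ [:: HashS] ++ enc_int tin ++ enc_int tout.

Inductive move := MoveL | MoveR | Stay.

Record TM := {
  tm_state : finType;
  tm_sym : finType;
  tm_blank : tm_sym;
  tm_input : sym -> tm_sym;
  tm_start : tm_state;
  tm_halting : tm_state -> bool;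
  tm_accepting : tm_state -> bool;
  tm_delta : tm_state -> tm_sym -> tm_state * tm_sym * move
}.

(* configuration: state, tape left of head (reversed), symbol under head,
   tape right of head *)
Record config (M : TM) := Config {
  c_state : tm_state M; c_left : seq (tm_sym M);
  c_head : tm_sym M; c_right : seq (tm_sym M) }.

Definition tm_step (M : TM) (cf : config M) : config M :=
  let: Config q l h r := cf in
  if tm_halting q then cf else
  let: (q', s', m) := tm_delta q h in
  match m with
  | MoveL => match l with
             | [::] => Config q' [::] (tm_blank M) (s' :: r)
             | x :: l' => Config q' l' x (s' :: r)
             end
  | MoveR => match r with
             | [::] => Config q' (s' :: l) (tm_blank M) [::]
             | x :: r' => Config q' (s' :: l) x r'
             end
  | Stay => Config q' l s' r
  end.

Definition tm_init (M : TM) (w : seq sym) : config M :=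
  match map (tm_input M) w with
  | [::] => Config (tm_start M) [::] (tm_blank M) [::]
  | a :: r => Config (tm_start M) [::] a r
  end.

Definition tm_run (M : TM) (n : nat) (w : seq sym) : config M :=
  ssrnat.iter n (@tm_step M) (tm_init M w).

Definition ptime_decides {X : Type} (M : TM) (enc : X -> seq sym)
    (dom : X -> Prop) (P : X -> Prop) : Prop :=
  exists c k : nat, forall x, dom x ->
    exists n : nat, (n <= c * (size (enc x)).+1 ^ k)%N /\
      tm_halting (c_state (tm_run M n (enc x))) /\
      (tm_accepting (c_state (tm_run M n (enc x))) <-> P x).

Definition DTP_instance (x : dataset * Z * Z) : Prop :=
  let: (D, tin, tout) := x in history tin D /\ (tout <= tin)%Z.

Definition DTP_holds (Q : query) (x : dataset * Z * Z) : Prop :=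
  let: (D, tin, tout) := x in DTP Q D tin tout.

(* Main.v *)
Require Import Defs.
From Stdlib Require Import ZArith Relations.
From mathcomp Require Import all_boot.
From HB Require Import structures.
From mathcomp Require Import zify.
From Stdlib Require Import NArith Classical ClassicalEpsilon FunctionalExtensionality.

Set Implicit Arguments.
Unset Strict Implicit.
Unset Printing Implicit Defensive.

(** A connected rule has at most one time variable, fixed by its head, and a
    nonrecursive program has derivations of bounded height. Hence whether
    [P(o, t)] is derivable, for [t] at a fixed offset of an input time, is a
    first-order property of the input word, with addition on positions: objects
    are named by the positions where they are written.

    DTP holds iff every tuple derivable from the data together with all
    conceivable facts after [tin] is already derivable from the data. Indeed a
    derivation uses finitely many future facts, so these form an update. All the
    objects outside the active domain can be collapsed to a single one, since
    both sets of facts are closed under this; a tuple with an inactive object is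
    never derivable from the data alone.

    First-order properties of words with addition are decided in polynomial time
    by a finite control with several heads: a quantifier is a loop moving a head.
    One step of such a device is a finite-state transduction of the word marked
    with the head positions, so a Turing machine performs it in a sweep. *)

(** * Charts and their simulation by a Turing machine *)

(** The two sorts need opposite treatments. Objects are written in binary, so they cannot be counted
    up to, and a position serves as a name. Times are never quantified: by connectedness a time
    variable of a rule is determined by the head, so every time met while unfolding the goal is
    [tout] or 0 shifted by an integer fixed by the query. What remains is to compare such shifts
    with [tin] and to recognise their numerals in the data. Unary notation enters here: it keeps the
    input times below the input length, so positions can hold them, and addition of positions reads
    a numeral as a distance. All that concerns the program (rules, constants, shifts, unfolding) is
    settled while the formula is built. Acyclicity bounds the unfolding, so the number of heads and
    the degree of the time bound depend on the query alone. *)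

Definition sym_code (a : sym) : 'I_7 :=
  match a with
  | B0 => @Ordinal 7 0 isT
  | B1 => @Ordinal 7 1 isT
  | UnitS => @Ordinal 7 2 isT
  | NegS => @Ordinal 7 3 isT
  | EndS => @Ordinal 7 4 isT
  | SepS => @Ordinal 7 5 isT
  | HashS => @Ordinal 7 6 isT
  end.

Definition sym_decode (i : 'I_7) : sym :=
  nth HashS [:: B0; B1; UnitS; NegS; EndS; SepS] i.

Lemma sym_codeK : cancel sym_code sym_decode.
Proof. by case. Qed.

HB.instance Definition _ := Finite.copy sym (can_type sym_codeK).

Definition store := nat -> nat.

Definition upd (T : Type) (st : nat -> T) (x : nat) (v : T) : nat -> T :=
  fun y => if y == x then v else st y.

(* Head instructions. A head standing at a position beyond the word carries no
   mark, so the two tests fail on it. *)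
Inductive op :=
| OZero of nat
| OInc of nat
| OCopy of nat & nat
| OSym of nat & sym
| OEq of nat & nat.

Definition exec_store (o : op) (st : store) : store :=
  match o with
  | OZero x => upd st x 0
  | OInc x => upd st x (st x).+1
  | OCopy x y => upd st x (st y)
  | _ => st
  end.

Definition exec_test (w : seq sym) (o : op) (st : store) : bool :=
  match o with
  | OSym x a => (st x < size w) && (nth EndS w (st x) == a)
  | OEq x y => (st x < size w) && (st x == st y)
  | _ => true
  end.

(** A flow chart over a read-only word: [next] receives the outcome of the instruction ([true] if it
    is not a test) and either names the next node or halts with a verdict. *)
Record chart := Chart {
  node : finType;
  code : node -> op;
  next : node -> bool -> node + bool }.

Inductive runs (ch : chart) (w : seq sym) :
    nat -> node ch -> store -> bool -> store -> Prop :=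
| runs_halt nd st b :
    next nd (exec_test w (code nd) st) = inr b ->
    runs w 1 nd st b (exec_store (code nd) st)
| runs_step t nd st nd' b st' :
    next nd (exec_test w (code nd) st) = inl nd' ->
    runs w t nd' (exec_store (code nd) st) b st' ->
    runs w t.+1 nd st b st'.

Section Simulation.

Variables (ch : chart) (K : nat).

(** Each cell records which heads stand on it. The exact place of a head beyond the word is lost,
    harmlessly: a head gets back only by a reset or a copy. *)
Definition marks := {ffun 'I_K.+1 -> bool}.

Definition mget (m : marks) (x : nat) : bool := m (inord x).
Definition mset (m : marks) (x : nat) (b : bool) : marks :=
  [ffun y => if y == inord x then b else m y].

Definition op_heads (o : op) : seq nat :=
  match o with
  | OZero x | OInc x | OSym x _ => [:: x]
  | OCopy x y | OEq x y => [:: x; y]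
  end.

(* Every instruction is a letter-to-letter transduction with one bit of memory. *)
Definition cell (o : op) (b : bool) (a : sym) (m : marks) : bool * marks :=
  match o with
  | OZero x => (true, mset m x (~~ b))
  | OInc x => (mget m x, mset m x b)
  | OCopy x y => (b, mset m x (mget m y))
  | OSym x s => (b || mget m x && (a == s), m)
  | OEq x y => (b || mget m x && mget m y, m)
  end.

Definition outcome (o : op) (b : bool) : bool :=
  match o with OSym _ _ | OEq _ _ => b | _ => true end.

Definition tsym : finType := option (sym * marks).
Definition tstate : finType := ((node ch * bool) + (node ch + bool))%type.

(** [inl (nd, b)] sweeps right performing [nd] with memory bit [b], [inr (inl nd)] rewinds before
    [nd], and [inr (inr r)] has halted with verdict [r]. The blank [None] delimits the word on both
    sides. *)
Definition delta (q : tstate) (h : tsym) : tstate * tsym * move :=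
  match q with
  | inl (nd, b) =>
    match h with
    | Some (a, m) => let: (b', m') := cell (code nd) b a m in
                     (inl (nd, b'), Some (a, m'), MoveR)
    | None => match next nd (outcome (code nd) b) with
              | inl nd' => (inr (inl nd'), None, MoveL)
              | inr r => (inr (inr r), None, Stay)
              end
    end
  | inr (inl nd) =>
    match h with
    | Some _ => (q, h, MoveL)
    | None => (inl (nd, false), None, MoveR)
    end
  | inr (inr _) => (q, h, Stay)
  end.

Definition sweep_tm (s : node ch) : TM := {|
  tm_state := tstate;
  tm_sym := tsym;
  tm_blank := None;
  tm_input := fun a => Some (a, [ffun => false]);
  tm_start := inl (s, false);
  tm_halting := fun q => if q is inr (inr _) then true else false;
  tm_accepting := fun q => if q is inr (inr true) then true else false;
  tm_delta := delta |}.

Variables (s : node ch) (w : seq sym).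
Hypothesis heads_le : forall nd x, x \in op_heads (code (c:=ch) nd) -> x <= K.

Notation M := (sweep_tm s).
Notation n := (size w).

Definition markat (st : store) (i : nat) : marks := [ffun y : 'I_K.+1 => st y == i].
Definition tcell (st : store) (i : nat) : tsym := Some (nth EndS w i, markat st i).
Definition cells (st : store) (i k : nat) : seq tsym := [seq tcell st j | j <- iota i k].

(** The memory bit on arrival at cell [i]: the first cell is passed (reset), the previous cell held
    the head (increment), or the test succeeded on an earlier cell. It is [false] at cell 0, and for
    a test it is the result at cell [size w]. *)
Definition bitat (o : op) (st : store) (i : nat) : bool :=
  match o with
  | OZero _ => i != 0
  | OInc x => (st x).+1 == i
  | OCopy _ _ => false
  | OSym x a => (st x < i) && (nth EndS w (st x) == a)
  | OEq x y => (st x < i) && (st x == st y)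
  end.

Lemma mget_markat st x i : x <= K -> mget (markat st i) x = (st x == i).
Proof. by move=> hx; rewrite /mget ffunE inordK. Qed.

Lemma mset_markat st x i v b : x <= K -> (v == i) = b ->
  mset (markat st i) x b = markat (upd st x v) i.
Proof.
move=> hx <-; apply/ffunP => y; rewrite !ffunE /upd.
suff -> : (y == inord x) = (nat_of_ord y == x) by case: ifP.
by rewrite -val_eqE /= inordK.
Qed.

Lemma cell_bitat o st i : (forall x, x \in op_heads o -> x <= K) ->
  cell o (bitat o st i) (nth EndS w i) (markat st i) =
  (bitat o st i.+1, markat (exec_store o st) i).
Proof.
case: o => [x|x|x y|x a|x y] hK;
  have hx : x <= K by [apply: hK; rewrite /= inE eqxx].
- by congr pair; apply: mset_markat => //; rewrite negbK eq_sym.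
- by rewrite /= mget_markat // eqSS; congr pair; apply: mset_markat.
- have hy : y <= K by apply: hK; rewrite /= !inE eqxx orbT.
  by rewrite /= mget_markat //; congr pair; apply: mset_markat.
- rewrite /= mget_markat //; congr pair.
  rewrite ltnS [in RHS]leq_eqVlt andb_orl orbC; congr orb.
  by case: (st x =P i) => [->|].
- have hy : y <= K by apply: hK; rewrite /= !inE eqxx orbT.
  rewrite /= !mget_markat //; congr pair.
  rewrite ltnS [in RHS]leq_eqVlt andb_orl orbC; congr orb.
  by case: (st x =P i) => [->|] //=; rewrite eq_sym.
Qed.

Definition mkconf (q : tm_state M) (l r : seq (tm_sym M)) : config M :=
  if r is a :: r' then Config q l a r' else Config q l (tm_blank M) [::].

Lemma sweep_right nd st k : forall i l r,
  iter k (@tm_step M) (mkconf (inl (nd, bitat (code nd) st i)) l (cells st i k ++ r)) =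
  mkconf (inl (nd, bitat (code nd) st (i + k)))
         (rev (cells (exec_store (code nd) st) i k) ++ l) r.
Proof.
elim: k => [|k IH] i l r; first by rewrite addn0.
rewrite iterSr /= cell_bitat; last exact: heads_le.
rewrite rev_cons cat_rcons addnS -addSn -IH.
by case: (_ ++ r).
Qed.

(** The rewind ends on the blank left of the word. It takes one of the [a] blanks there, or a fresh
    one if [a] is 0; hence [a.-1]. *)
Lemma sweep_left nd ls : forall x r a, all isSome (x :: ls) ->
  iter (size ls).+1 (@tm_step M) (Config (inr (inl nd) : tm_state M) (ls ++ nseq a None) x r) =
  Config (inr (inl nd) : tm_state M) (nseq a.-1 None) None (rev (x :: ls) ++ r).
Proof.
elim: ls => [|y ls IH] x r a.
  by case: x => // x _; case: a.
case: x => // x hy; rewrite iterSr.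
transitivity (iter (size ls).+1 (@tm_step M)
  (Config (inr (inl nd) : tm_state M) (ls ++ nseq a None) y (Some x :: r))); first by [].
by rewrite IH // !rev_cons !cat_rcons.
Qed.

Lemma all_cells st i k : all isSome (cells st i k).
Proof. by rewrite all_map; apply/allP. Qed.

(** Each round leaves blanks around the word, so the induction is over arbitrary numbers [a] and [c]
    of them. An instruction costs at most [2n + 2] steps: two sweeps and two turns. The rewind
    starts on the last cell, so the word must be nonempty. *)
Lemma tm_simulates t nd st b st' : 0 < n -> runs w t nd st b st' ->
  forall a c, exists2 T, T <= t * n.+1.*2 &
    c_state (iter T (@tm_step M)
      (mkconf (inl (nd, false)) (nseq a None) (cells st 0 n ++ nseq c None)))
    = inr (inr b).
Proof.
move=> n0; elim=> {t nd st b st'} [nd st b|t nd st nd' b st'] Hn.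
- move=> a c; exists (n.+1); first by rewrite mul1n -addnn leq_addl.
  have := sweep_right nd st n 0 (nseq a None) (nseq c None).
  have -> : bitat (code nd) st 0 = false by case: (code nd).
  rewrite iterS => ->; rewrite add0n.
  have -> : forall l, @tm_step M (mkconf (inl (nd, bitat (code nd) st n)) l (nseq c None)) =
         mkconf (inr (inr b)) l (None :: nseq c.-1 None).
    move=> l; have E : next nd (outcome (code nd) (bitat (code nd) st n)) = inr b.
      by rewrite -Hn; case: (code nd).
    by case: c => [|c] /=; rewrite E.
  by [].
- move=> _ IH a c.
  have [T hT ET] := IH a.-1.+1 c.-1.+1.
  exists (T + (1 + (n + (1 + n)))); first by lia.
  have := sweep_right nd st n 0 (nseq a None) (nseq c None).
  have -> : bitat (code nd) st 0 = false by case: (code nd).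
  rewrite !iterD => ->; rewrite add0n.
  have E : next nd (outcome (code nd) (bitat (code nd) st n)) = inl nd'.
    by rewrite -Hn; case: (code nd).
  set st1 := exec_store _ _ in ET *.
  have : all isSome (rev (cells st1 0 n)) by rewrite all_rev all_cells.
  have : size (rev (cells st1 0 n)) = n by rewrite size_rev size_map size_iota.
  case ls: (rev (cells st1 0 n)) => [|x ls'] /=; first by move=> h; rewrite -h in n0.
  move=> sz hall.
  have -> : @tm_step M (mkconf (inl (nd, bitat (code nd) st n)) (x :: ls' ++ nseq a None)
                 (nseq c None)) =
         Config (inr (inl nd') : tm_state M) (ls' ++ nseq a None) x (nseq c.-1.+1 None).
    by case: c {ET} => [|c] /=; rewrite E.
  rewrite -[in iter n]sz sweep_left // -ls revK.
  have -> : @tm_step M (Config (inr (inl nd') : tm_state M) (nseq a.-1 None) None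
                         (cells st1 0 n ++ nseq c.-1.+1 None)) =
          mkconf (inl (nd', false)) (nseq a.-1.+1 None) (cells st1 0 n ++ nseq c.-1.+1 None).
    by rewrite /=; case: (cells st1 0 n ++ _).
  exact: ET.
Qed.

(** With all heads just past the word, no cell is marked, which is the tape given as input. *)
Lemma tm_init_cells : tm_init M w = mkconf (inl (s, false)) [::] (cells (fun=> n) 0 n).
Proof.
have -> : cells (fun=> n) 0 n = map (tm_input M) w.
  rewrite /cells -[in RHS](mkseq_nth EndS w) -map_comp.
  apply/eq_in_map => i; rewrite mem_iota add0n /= => hi; congr Some; congr pair.
  by apply/ffunP => y; rewrite !ffunE gtn_eqF.
by rewrite /tm_init; case: (map _ w).
Qed.

Lemma sweep_tm_runs t b st' : 0 < n -> runs w t s (fun=> n) b st' ->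
  exists2 T, T <= t * n.+1.*2 & c_state (tm_run M T w) = inr (inr b).
Proof.
move=> n0 /(tm_simulates n0) /(_ 0 0) [T hT E]; exists T => //.
by rewrite /tm_run tm_init_cells -[cells _ _ _]cats0.
Qed.

End Simulation.

(** * Definable relations on positions *)

(** The gluing principle for charts: a copy of [A] runs inside [B], and [k] redirects its verdict to
    a verdict of [B] or to a node where the run continues. *)
Lemma runs_embed (A B : chart) (f : node A -> node B) (k : bool -> node B + bool) w :
  (forall nd, code (f nd) = code nd) ->
  (forall nd b, next (f nd) b =
     match next nd b with inl nd' => inl (f nd') | inr r => k r end) ->
  forall t nd st r st', runs w t nd st r st' ->
  (forall b, k r = inr b -> runs w t (f nd) st b st') /\
  (forall nd' t' b st'', k r = inl nd' -> runs w t' nd' st' b st'' ->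
     runs w (t + t') (f nd) st b st'').
Proof.
move=> hc hn t nd st r st'.
elim=> {t nd st r st'} [nd st r E|t nd st nd' r st' E _ [IH1 IH2]]; split.
- move=> b kb; rewrite -hc; apply: runs_halt; by rewrite hn hc E.
- move=> nd' t' b st'' kb h; apply: (@runs_step B w t' _ _ nd'); last by rewrite hc.
  by rewrite hn hc E.
- move=> b kb; apply: (@runs_step B w _ _ _ (f nd')); last by rewrite hc; apply: IH1.
  by rewrite hn hc E.
- move=> nd'' t' b st'' kb h; rewrite addSn.
  apply: (@runs_step B w _ _ _ (f nd')); last by rewrite hc; apply: IH2 kb h.
  by rewrite hn hc E.
Qed.

Section Definability.

Variables (X : Type) (enc : X -> seq sym) (dom : X -> Prop).
Hypothesis enc_gt0 : forall x, dom x -> 0 < size (enc x).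

Notation len x := (size (enc x)).

(** Heads from [d] on are scratch: nothing is assumed or promised about them, so subcharts can reuse
    them. *)
Definition agree (d : nat) (e : seq nat) (st : store) : Prop :=
  forall i, i < d -> st i = nth 0 e i.

Definition in_word (x : X) (e : seq nat) : Prop := forall i, i < size e -> nth 0 e i < len x.

(* Some chart decides [R x e] in polynomial time when started with its first [d]
   heads at the positions [e]. *)
Definition def (d : nat) (R : X -> seq nat -> Prop) : Prop :=
  exists (ch : chart) (s : node ch) (c k : nat),
  forall x e st, dom x -> size e = d -> in_word x e -> agree d e st ->
  exists t b st', [/\ t <= c * (len x).+1 ^ k, runs (enc x) t s st b st',
                      agree d e st' & (b <-> R x e)].

Lemma def_ext d (R R' : X -> seq nat -> Prop) :
  (forall x e, dom x -> size e = d -> in_word x e -> (R x e <-> R' x e)) ->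
  def d R -> def d R'.
Proof.
move=> h [ch [s [c [k H]]]]; exists ch, s, c, k => x e st hx he hw ha.
have [t [b [st' [h1 h2 h3 h4]]]] := H x e st hx he hw ha.
by exists t, b, st'; split=> //; rewrite h4; apply: h.
Qed.

Lemma def_not d R : def d R -> def d (fun x e => ~ R x e).
Proof.
case=> ch [s [c [k H]]].
pose ch' := @Chart (node ch) (@code ch) (fun nd b =>
  match next nd b with inl nd' => inl nd' | inr r => inr (~~ r) end).
exists ch', s, c, k => x e st hx he hw ha.
have [t [b [st' [h1 h2 h3 h4]]]] := H x e st hx he hw ha.
exists t, (~~ b), st'; split=> //; last by rewrite -h4; case: (b); split=> //; case.
by have [h _] := @runs_embed ch ch' id (fun r => inr (~~ r)) (enc x)
  (fun=> erefl) (fun _ _ => erefl) _ _ _ _ _ h2; apply: h.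
Qed.

Lemma def_and d R S : def d R -> def d S -> def d (fun x e => R x e /\ S x e).
Proof.
case=> ch1 [s1 [c1 [k1 H1]]] [ch2 [s2 [c2 [k2 H2]]]].
pose ch := @Chart (node ch1 + node ch2)%type
  (fun nd => match nd with inl a => code a | inr a => code a end)
  (fun nd b => match nd with
   | inl a => match next a b with
              | inl a' => inl (inl a')
              | inr r => if r then inl (inr s2) else inr false end
   | inr a => match next a b with
              | inl a' => inl (inr a') | inr r => inr r end end).
exists ch, (inl s1), (c1 + c2), (k1 + k2) => x e st hx he hw ha.
have [t1 [b1 [st1 [t1le r1 a1 E1]]]] := H1 x e st hx he hw ha.
have [t2 [b2 [st2 [t2le r2 a2 E2]]]] := H2 x e st1 hx he hw a1.
have [h1 h1'] := @runs_embed ch1 ch (fun a => inl a)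
  (fun r => if r then inl (inr s2) else inr false) (enc x)
  (fun=> erefl) (fun _ _ => erefl) _ _ _ _ _ r1.
have [h2 _] := @runs_embed ch2 ch (fun a => inr a)
  (fun r => inr r) (enc x) (fun=> erefl) (fun _ _ => erefl) _ _ _ _ _ r2.
have le1 : t1 <= c1 * (len x).+1 ^ (k1 + k2).
  by apply: leq_trans t1le _; rewrite leq_mul2l leq_pexp2l ?orbT // leq_addr.
have le2 : t2 <= c2 * (len x).+1 ^ (k1 + k2).
  by apply: leq_trans t2le _; rewrite leq_mul2l leq_pexp2l ?orbT // leq_addl.
case: b1 E1 h1 h1' {r1} => E1 h1 h1'.
- exists (t1 + t2), b2, st2; split=> //; first by rewrite mulnDl leq_add.
  + by apply: h1' => //; apply: h2.
  + by rewrite E2; split=> [|[]//]; split=> //; apply/E1.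
- exists t1, false, st1; split=> //; first by rewrite mulnDl (leq_trans le1) ?leq_addr.
  + exact: h1.
  + by split=> // -[/E1].
Qed.

Lemma agree_upd d e st i v : agree d e st -> d <= i -> agree d e (upd st i v).
Proof.
by move=> h di j jd; rewrite /upd ltn_eqF ?(leq_trans jd) // h.
Qed.

Lemma agree_rcons d e st v : agree d e st -> size e = d -> st d = v ->
  agree d.+1 (rcons e v) st.
Proof.
move=> h he hv i; rewrite ltnS leq_eqVlt nth_rcons he => /orP[/eqP->|id].
  by rewrite ltnn eqxx.
by rewrite id h.
Qed.

Lemma agree_take d e v st : agree d.+1 (rcons e v) st -> size e = d -> agree d e st.
Proof. by move=> h he i id; rewrite h ?nth_rcons ?he ?id // ltnW. Qed.

(** Head [d] loops over the word, and the chart of the body runs at each position until it accepts.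
    This multiplies the time by the length, hence the exponent [k.+1]. *)
Lemma def_ex d (B : X -> seq nat -> nat -> Prop) :
  def d.+1 (fun x e => B x (take d e) (nth 0 e d)) ->
  def d (fun x e => exists v, v < len x /\ B x e v).
Proof.
case=> ch [s [c [k H]]].
pose ch' := @Chart (option bool + node ch)%type
  (fun nd => match nd with
   | inl None => OZero d
   (* [OEq d d] fails only when head [d] has left the word, so it is the loop test. *)
   | inl (Some true) => OEq d d
   | inl (Some false) => OInc d
   | inr a => code a end)
  (fun nd b => match nd with
   | inl None => inl (inl (Some true))
   | inl (Some true) => if b then inl (inr s) else inr false
   | inl (Some false) => inl (inl (Some true))
   | inr a => match next a b with
              | inl a' => inl (inr a')
              | inr r => if r then inr true else inl (inl (Some false)) end end).
exists ch', (inl None), (c + 4), k.+1 => x e st hx he hw ha.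
have loop m : forall st v, v + m = len x -> agree d e st -> st d = v ->
  exists t b st', [/\ t <= m * (c * (len x).+1 ^ k + 2) + 1,
    @runs ch' (enc x) t (inl (Some true)) st b st', agree d e st' &
    (b <-> exists v', [/\ v <= v', v' < len x & B x e v'])].
  elim: m => [|m IH] {ha} st0 v vm ha hv.
    exists 1, false, st0; split=> //; last first.
      by split=> // -[v' [h1 h2 _]]; move: h2; rewrite -vm addn0 ltnNge h1.
    by apply: runs_halt => /=; rewrite hv -vm addn0 ltnn.
  have vx : v < len x by rewrite -vm addnS ltnS leq_addr.
  have hw' : in_word x (rcons e v).
    move=> i; rewrite size_rcons nth_rcons ltnS leq_eqVlt => /orP[/eqP->|ie].
      by rewrite ltnn eqxx.
    by rewrite ie hw.
  have := H x (rcons e v) st0 hx _ hw' (agree_rcons ha he hv).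
  rewrite size_rcons he => /(_ erefl) [t [b [st1 [tle r1 a1 E1]]]].
  move: E1; rewrite -cats1 take_size_cat // nth_cat he ltnn subnn /= => E1.
  have enter : @next ch' (inl (Some true)) (exec_test (enc x) (OEq d d) st0) = inl (inr s).
    by rewrite /= hv vx eqxx.
  have [h1 h1'] := @runs_embed ch ch' (fun a => inr a)
    (fun r => if r then inr true else inl (inl (Some false))) (enc x)
    (fun=> erefl) (fun _ _ => erefl) _ _ _ _ _ r1.
  have a1d := agree_take a1 he.
  case: b E1 h1 h1' {r1} => E1 h1 h1'.
    exists t.+1, true, st1; split=> //; first by rewrite mulSn; lia.
      by apply: (runs_step (nd' := inr s : node ch')); [exact: enter | exact: h1].
    by split=> // _; exists v; split=> //; apply/E1.
  have hst1 : st1 d = v by rewrite a1 // nth_rcons he ltnn eqxx.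
  have [|||t2 [b2 [st2 [t2le r2 a2 E2]]]] := IH (upd st1 d (st1 d).+1) v.+1.
  - by rewrite addSnnS.
  - exact: agree_upd.
  - by rewrite /upd eqxx hst1.
  exists (t + t2.+1).+1, b2, st2; split=> //.
  - by rewrite mulSn; lia.
  - apply: (runs_step (nd' := inr s : node ch')); first exact: enter.
    apply: h1' => //.
    by apply: (runs_step (nd' := inl (Some true) : node ch')).
  - rewrite E2; split=> -[v' [q1 q2 q3]]; exists v'; split=> //; first exact: ltnW.
    rewrite ltn_neqAle q1 andbT; apply/eqP => vv'; rewrite -vv' in q3.
    by have := E1.2 q3.
have [|||t [b [st' [tle r a E]]]] := loop (len x) (upd st d 0) 0.
- by rewrite add0n.
- exact: agree_upd.
- by rewrite /upd eqxx.
exists t.+1, b, st'; split=> //.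
- rewrite expnS; have : 0 < (len x).+1 ^ k by rewrite expn_gt0.
  move: tle; set N := _ ^ k; nia.
- by apply: (runs_step (nd' := inl (Some true) : node ch')).
- by rewrite E; split=> [[v [_ h1 h2]]|[v [h1 h2]]]; exists v.
Qed.

(** Coordinates are taken up to extensionality because under a quantifier they are read through
    [take]. *)
Definition is_proj (d : nat) (p : seq nat -> nat) : Prop :=
  exists2 i, i < d & forall e, size e = d -> p e = nth 0 e i.

Lemma proj_lt d p x e : is_proj d p -> size e = d -> in_word x e -> p e < len x.
Proof. by case=> i id h he hw; rewrite h //; apply: hw; rewrite he. Qed.

Lemma proj_comp d d' p t : is_proj d p ->
  (forall e, size e = d' -> size (t e) = d /\ forall i, i < d -> nth 0 (t e) i = nth 0 e i) ->
  d <= d' -> is_proj d' (fun e => p (t e)).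
Proof.
case=> i id h ht dd'; exists i; first exact: leq_trans dd'.
by move=> e he; have [h1 h2] := ht e he; rewrite h ?h2.
Qed.

Lemma def_sym d p a : is_proj d p -> def d (fun x e => nth EndS (enc x) (p e) = a).
Proof.
move=> hp.
have [i id hi] := hp.
pose ch := @Chart unit (fun=> OSym i a) (fun _ b => inr b).
exists ch, tt, 1, 0 => x e st hx he hw ha.
exists 1, (exec_test (enc x) (OSym i a) st), st; split=> //; first exact: runs_halt.
rewrite /= ha // -hi // (proj_lt hp he hw) /=; split=> [/eqP|->] //.
Qed.

(** Scratch head [d] starts at the first summand and [d.+1] at 0; both advance until [d.+1] meets
    the second summand, and then [d] is at the sum. If the sum lies outside the word, the last test
    fails, rightly, as [r e] is inside. *)
Lemma def_plus d p q r : is_proj d p -> is_proj d q -> is_proj d r ->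
  def d (fun _ e => p e + q e = r e).
Proof.
move=> hp hq hr; have [i id hi] := hp; have [j jd hj] := hq; have [l ld hl] := hr.
pose ch := @Chart (option bool * bool)%type
  (fun nd => match nd with
   | (None, false) => OCopy d i
   | (None, true) => OZero d.+1
   | (Some false, false) => OEq d.+1 j
   | (Some false, true) => OEq d l
   | (Some true, false) => OInc d
   | (Some true, true) => OInc d.+1 end)
  (fun nd b => match nd with
   | (None, false) => inl (None, true)
   | (None, true) => inl (Some false, false)
   | (Some false, false) => if b then inl (Some false, true) else inl (Some true, false)
   | (Some false, true) => inr b
   | (Some true, false) => inl (Some true, true)
   | (Some true, true) => inl (Some false, false) end).
exists ch, (None, false), 7, 1 => x e st hx he hw ha.
have px := proj_lt hp he hw; have qx := proj_lt hq he hw; have rx := proj_lt hr he hw.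
have loop m : forall st v, v + m = q e -> agree d e st -> st d = p e + v -> st d.+1 = v ->
  exists t b st', [/\ t <= 3 * m + 2, @runs ch (enc x) t (Some false, false) st b st',
    agree d e st' & (b <-> p e + q e = r e)].
  elim: m => [|m IH] {ha} st0 v vm ha hu hv.
    have vq : v = q e by rewrite -vm addn0.
    exists 2, (exec_test (enc x) (OEq d l) st0), st0; split=> //.
      apply: (runs_step (nd' := (Some false, true) : node ch)); last exact: runs_halt.
      by rewrite /= hv [st0 j]ha // -hj // vq qx eqxx.
    rewrite /= hu vq [st0 l]ha // -hl //; split=> [/andP[_ /eqP] //|E].
    by rewrite E rx eqxx.
  have [||||t [b [st' [tle rr a' E]]]] :=
    IH (upd (upd st0 d (st0 d).+1) d.+1 v.+1) v.+1.
  - by rewrite addSnnS.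
  - by do 2! apply: agree_upd => //.
  - by rewrite /upd eqxx ltn_eqF // hu addnS.
  - by rewrite /upd eqxx.
  exists t.+3, b, st'; split=> //; first by lia.
  apply: (runs_step (nd' := (Some true, false) : node ch)).
    rewrite /= hv [st0 j]ha // -hj //.
    have -> : (v == q e) = false by lia.
    by rewrite andbF.
  apply: (runs_step (nd' := (Some true, true) : node ch)) => //.
  apply: (runs_step (nd' := (Some false, false) : node ch)) => //=.
  have -> : upd st0 d (st0 d).+1 d.+1 = v by rewrite /upd gtn_eqF.
  exact: rr.
have [||||t [b [st' [tle rr a' E]]]] := loop (q e) (upd (upd st d (st i)) d.+1 0) 0.
- by rewrite add0n.
- by do 2! apply: agree_upd => //.
- by rewrite /upd eqxx ltn_eqF // addn0 ha // hi.
- by rewrite /upd eqxx.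
exists t.+2, b, st'; split=> //; first by rewrite expn1; lia.
apply: (runs_step (nd' := (None, true) : node ch)) => //.
by apply: (runs_step (nd' := (Some false, false) : node ch)).
Qed.

(** [K] is the largest head that the chart mentions. Each instruction costs [2(n + 1)] machine
    steps, whence [c * 2] and [k.+1]. *)
Lemma def_ptime (R : X -> Prop) : def 0 (fun x _ => R x) ->
  exists M : TM, ptime_decides M enc dom R.
Proof.
case=> ch [s [c [k H]]].
pose K := \max_(nd : node ch) \max_(x <- op_heads (code nd)) x.
have hK nd x : x \in op_heads (code (c:=ch) nd) -> x <= K.
  move=> hx.
  apply: leq_trans (leq_bigmax (F := fun nd => \max_(x <- op_heads (code nd)) x) nd).
  exact: (leq_bigmax_seq (F := id)).
exists (sweep_tm K s), (c * 2), k.+1 => x hx.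
have [] := H x [::] (fun=> len x) hx erefl; rewrite /in_word /agree //.
move=> t [b [st' [tle r _ E]]].
have [T TT hT] := sweep_tm_runs hK (enc_gt0 hx) r.
exists T; split; first by apply: (leq_trans TT); rewrite expnS -muln2; nia.
by rewrite hT /=; split=> //; rewrite -E; case: (b).
Qed.

Lemma def_or d R S : def d R -> def d S -> def d (fun x e => R x e \/ S x e).
Proof.
move=> hR hS; apply: (def_ext _ (def_not (def_and (def_not hR) (def_not hS)))).
move=> x e _ _ _; split=> [h|[h|h] []//].
by apply: NNPP => h'; apply: h; split=> h; apply: h'; [left|right].
Qed.

Lemma def_imp d R S : def d R -> def d S -> def d (fun x e => R x e -> S x e).
Proof.
move=> hR hS; apply: (def_ext _ (def_or (def_not hR) hS)).
move=> x e _ _ _; split=> [[h|h]//|h].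
by case: (classic (R x e)) => h'; [right; apply: h|left].
Qed.

Lemma def_all d (B : X -> seq nat -> nat -> Prop) :
  def d.+1 (fun x e => B x (take d e) (nth 0 e d)) ->
  def d (fun x e => forall v, v < len x -> B x e v).
Proof.
move=> /def_not h; apply: (def_ext _ (def_not (def_ex (B := fun x e v => ~ B x e v) h))).
move=> x e _ _ _; split=> [h' v vx|h' [v [vx]]]; last by apply; apply: h'.
by apply: NNPP => nb; apply: h'; exists v.
Qed.

Lemma def_true d : def d (fun _ _ => True).
Proof.
pose ch := @Chart unit (fun=> OCopy d d) (fun _ _ => inr true).
exists ch, tt, 1, 0 => x e st hx he hw ha.
exists 1, true, (exec_store (OCopy d d) st); split=> //; first exact: runs_halt.
exact: agree_upd.
Qed.

(** [P] does not depend on the input, so its truth value merely selects one of two constant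
    charts. *)
Lemma def_const d (P : Prop) : def d (fun _ _ => P).
Proof.
case: (classic P) => hP; first exact: def_ext (def_true d).
by apply: def_ext (def_not (def_true d)) => x e _ _ _; split=> [[]|].
Qed.

End Definability.

(** * First-order arithmetic of positions *)

Ltac proj :=
  match goal with
  | H : is_proj ?d ?p |- is_proj ?d ?p => exact H
  | |- is_proj _ (fun e => nth 0 (@?t e) ?i) =>
      exists i; [lia | by move=> ? ?; rewrite ?nth_take; try lia]
  | H : is_proj _ ?p |- is_proj _ (fun e => ?p (@?t e)) =>
      apply: (proj_comp (t := t) H); [|lia];
      move=> ? ?; rewrite !size_take_min; split; [lia|];
      move=> ? ?; rewrite !nth_take; lia
  end.

(* Reduces definability of a first-order formula to that of its atoms. *)
Ltac fo :=
  cbv beta;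
  lazymatch goal with
  | |- is_proj _ _ => proj
  | |- def ?en ?dm ?d (fun x e => exists v, is_true (v < size (?en x)) /\ @?B x e v) =>
      apply: (@def_ex _ en dm d B); fo
  | |- def ?en ?dm ?d (fun x e => forall v, is_true (v < size (?en x)) -> @?B x e v) =>
      apply: (@def_all _ en dm d B); fo
  | |- def ?en ?dm ?d (fun x e => ~ @?R x e) => apply: (@def_not _ en dm d R); fo
  | |- def ?en ?dm ?d (fun x e => @?R x e /\ @?S x e) =>
      apply: (@def_and _ en dm d R S); fo
  | |- def ?en ?dm ?d (fun x e => @?R x e \/ @?S x e) =>
      apply: (@def_or _ en dm d R S); fo
  | |- def ?en ?dm ?d (fun x e => @?R x e -> @?S x e) =>
      apply: (@def_imp _ en dm d R S); fo
  | |- _ => try solve [eauto 4 with definable | apply: def_sym; proj | apply: def_plus; proj]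
  end.

#[export] Hint Extern 1 (is_proj _ _) => proj : definable.

Section Arithmetic.

Variables (X : Type) (enc : X -> seq sym) (dom : X -> Prop).
Hypothesis enc_gt0 : forall x, dom x -> 0 < size (enc x).
Notation len x := (size (enc x)).
Notation def := (def enc dom).

(** Letters and addition are the only atoms: zero is the additive idempotent, equality is addition
    of zero, and one is the nonzero number that is not a sum of two nonzero ones. *)
Lemma def_zero d p : is_proj d p -> def d (fun _ e => p e = 0).
Proof.
move=> hp; apply: (def_ext (R := fun _ e => p e + p e = p e)); last by fo.
by move=> x e _ _ _; lia.
Qed.
Hint Resolve def_zero : definable.

Lemma def_eq d p q : is_proj d p -> is_proj d q -> def d (fun _ e => p e = q e).
Proof.
move=> hp hq.
apply: (def_ext (R := fun x e => exists z, z < len x /\ (z = 0 /\ z + p e = q e))); last by fo.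
move=> x e hx _ _; split=> [[z [_ [-> <-]]] //|->]; exists 0; split=> //; exact: enc_gt0.
Qed.
Hint Resolve def_eq : definable.

Lemma def_one d p : is_proj d p -> def d (fun _ e => p e = 1).
Proof.
move=> hp.
apply: (def_ext (R := fun x e => ~ (p e = 0) /\ forall s, s < len x -> forall t, t < len x ->
   s + t = p e -> s = 0 \/ t = 0)); last by fo.
move=> x e hx he hw; have := proj_lt hp he hw; move: (p e) => m mn.
split=> [[m0 h]|->]; last by split=> // s _ t _; lia.
case: m m0 mn h => [|[|m]] // _ mn /(_ 1) h; have [] := h _ m.+1 _ _; lia.
Qed.
Hint Resolve def_one : definable.

Lemma def_suc d p q : is_proj d p -> is_proj d q -> def d (fun _ e => (p e).+1 = q e).
Proof.
move=> hp hq.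
apply: (def_ext (R := fun x e => exists o, o < len x /\ (o = 1 /\ p e + o = q e))); last by fo.
move=> x e hx he hw; have hn := proj_lt hq he hw.
split=> [[z [_ [-> <-]]]|E]; first by rewrite addn1.
by exists 1; rewrite addn1; split=> //; lia.
Qed.
Hint Resolve def_suc : definable.

Lemma def_natconst d p c : is_proj d p -> def d (fun _ e => p e = c).
Proof.
elim: c d p => [|c IH] d p hp; first by fo.
apply: (def_ext (R := fun x e => exists v, v < len x /\ (v = c /\ v.+1 = p e))).
  move=> x e hx he hw; have := proj_lt hp he hw.
  by split=> [[v [_ [-> <-]]] //|E]; exists c; split=> //; lia.
by fo; apply: IH; proj.
Qed.
Hint Resolve def_natconst : definable.

Lemma def_le d p q : is_proj d p -> is_proj d q -> def d (fun _ e => p e <= q e).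
Proof.
move=> hp hq.
apply: (def_ext (R := fun x e => exists r, r < len x /\ (p e + r = q e))); last by fo.
move=> x e hx he hw; have := proj_lt hq he hw.
by split=> [[v [_ <-]]|E]; [lia|exists (q e - p e); lia].
Qed.
Hint Resolve def_le : definable.

Lemma def_lt d p q : is_proj d p -> is_proj d q -> def d (fun _ e => p e < q e).
Proof.
move=> hp hq.
apply: (def_ext (R := fun x e => p e <= q e /\ ~ (p e = q e))); last by fo.
by move=> x e hx he hw; lia.
Qed.
Hint Resolve def_lt : definable.

Lemma def_exlist d (T : Type) (s : seq T) (R : T -> X -> seq nat -> Prop) :
  (forall t, List.In t s -> def d (R t)) ->
  def d (fun x e => exists t, List.In t s /\ R t x e).
Proof.
elim: s => [|a s IH] h.
  by apply: (def_ext _ (def_const enc dom d False)) => x e _ _ _; split=> // -[t []].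
apply: (def_ext (R := fun x e => R a x e \/ exists t, List.In t s /\ R t x e)).
  move=> x e _ _ _; split=> [[h'|[t [h1 h2]]]|[t [[<-|h1] h2]]].
  - by exists a; split=> //; left.
  - by exists t; split=> //; right.
  - by left.
  - by right; exists t.
apply: def_or; first by apply: h; left.
by apply: IH => t ht; apply: h; right.
Qed.

(** The sum may lie outside the word, where no quantifier reaches it; so the finitely many pairs
    with sum at most [c] are listed. *)
Lemma def_sum_le d p q c : is_proj d p -> is_proj d q -> def d (fun _ e => p e + q e <= c).
Proof.
move=> hp hq.
apply: (def_ext (R := fun _ e => exists i, List.In i (iota 0 c.+1) /\
  (p e = i /\ exists j, List.In j (iota 0 (c - i).+1) /\ q e = j))).
  have inP i m : List.In i (iota 0 m.+1) <-> i <= m.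
    suff H a : List.In i (iota a m.+1) <-> a <= i <= a + m by rewrite H.
    elim: m a => [|m IH] a; first by split=> [[<-|[]]|h]; [lia|left; lia].
    split=> [[<-|/IH]|h]; [lia|lia|].
    by case: (eqVneq a i) => [->|ne]; [left|right; apply/IH; lia].
  move=> x e _ _ _; split=> [[i [/inP h1 [h2 [j [/inP h3 h4]]]]]|h]; first by lia.
  by exists (p e); split; [apply/inP; lia|split=> //; exists (q e); split=> //; apply/inP; lia].
apply: def_exlist => i _; fo.
by apply: def_exlist => j _; fo.
Qed.

Lemma def_add_le d p q c : is_proj d p -> is_proj d q -> def d (fun _ e => p e + c <= q e).
Proof.
move=> hp hq.
apply: (def_ext (R := fun x e => exists v, v < len x /\ (v = c /\
  exists r, r < len x /\ (p e + v = r /\ r <= q e)))); last by fo.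
move=> x e hx he hw; have hn := proj_lt hq he hw.
split=> [[v [_ [-> [r [_ [<-]]]]]]//|h].
by exists c; do 2?[split=> //]; [lia|exists (p e + c); do 2?[split=> //]; lia].
Qed.

Definition signed (s : bool) (m : nat) : Z :=
  if s then Z.of_nat m else (- Z.of_nat m)%Z.

(** All three signs are known, so the terms can be moved to the sides where they are natural
    numbers; each case then comes from [def_add_le], [def_sum_le] or a constant. *)
Lemma def_signed_le d s p k s' q : is_proj d p -> is_proj d q ->
  def d (fun _ e => (signed s (p e) + k <= signed s' (q e))%Z).
Proof.
move=> hp hq; have [c [->|->]] : exists c : nat, k = Z.of_nat c \/ k = (- Z.of_nat c)%Z.
- by exists (Z.abs_nat k); lia.
- case: s; case: s'; rewrite /signed.
  + by apply: (def_ext _ (def_add_le c hp hq)) => x e _ _ _; lia.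
  + apply: (def_ext (R := fun x e => p e + q e <= 0 /\ c = 0)).
      by move=> x e _ _ _; lia.
    by apply: def_and; [exact: def_sum_le | exact: def_const].
  + case: c => [|c].
      by apply: (def_ext (R := fun _ _ => True)); [move=> x e _ _ _; lia|exact: def_const].
    apply: (def_ext _ (def_not (def_sum_le c hp hq))) => x e _ _ _; lia.
  + by apply: (def_ext _ (def_add_le c hq hp)) => x e _ _ _; lia.
- case: s; case: s'; rewrite /signed.
  + apply: (def_ext _ (def_not (def_add_le c.+1 hq hp))) => x e _ _ _; lia.
  + apply: (def_ext _ (def_sum_le c hp hq)) => x e _ _ _; lia.
  + by apply: (def_ext (R := fun _ _ => True)); [move=> x e _ _ _; lia|exact: def_const].
  + apply: (def_ext _ (def_not (def_add_le c.+1 hp hq))) => x e _ _ _; lia.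
Qed.

(* The end [q] must be a position of [w], as only these can be quantified over. *)
Definition seg (w u : seq sym) (p q : nat) : Prop :=
  [/\ q < size w, p + size u = q &
      forall i, i < size u -> nth EndS w (p + i) = nth EndS u i].

Lemma segP w u p q : seg w u p q <->
  exists r1 r2, [/\ w = r1 ++ u ++ r2, size r1 = p, p + size u = q & 0 < size r2].
Proof.
split=> [[qw pq h]|[r1 [r2 [-> <- <- h]]]]; last first.
  split=> //; first by rewrite !size_cat; lia.
  by move=> i iu; rewrite nth_cat ltnNge leq_addr addKn nth_cat iu.
exists (take p w), (drop q w); split=> //; last by rewrite size_drop subn_gt0.
- rewrite -[LHS](cat_take_drop p); congr cat.
  rewrite -[LHS](cat_take_drop (size u)) drop_drop addnC pq; congr cat.
  apply: (@eq_from_nth _ EndS); first by rewrite size_takel // size_drop; lia.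
  rewrite size_takel; last by rewrite size_drop; lia.
  by move=> i iu; rewrite nth_take // nth_drop h.
- by rewrite size_takel //; lia.
Qed.

(** The cutting point is a quantified position: this turns a code built by concatenation into a
    formula, piece by piece. *)
Lemma seg_cat w u v p q :
  seg w (u ++ v) p q <-> exists m, m < size w /\ (seg w u p m /\ seg w v m q).
Proof.
split=> [[qw pq h]|[m [mw [[_ pm hu] [qw mq hv]]]]]; last subst m.
  rewrite size_cat in pq h.
  have lw : p + size u < size w by lia.
  exists (p + size u); split=> //; split; split=> //; last 1 first.
  - by move=> i iv; rewrite -addnA h ?nth_cat ?ltn_add2l // ltnNge leq_addr addKn.
  - by move=> i iu; rewrite h ?nth_cat ?iu //; lia.
  - by lia.
rewrite /seg size_cat; split; [by []|lia|].
move=> i iuv; rewrite nth_cat; case: ltnP => iu; first exact: hu.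
by rewrite -hv; [congr nth; lia|lia].
Qed.

Lemma seg_nil w p q : q < size w -> seg w [::] p q <-> p = q.
Proof. by move=> qw; split=> [[_ <- _]|->]; rewrite ?addn0 //; split=> //; rewrite addn0. Qed.

Lemma seg1 w a p q : q < size w -> seg w [:: a] p q <-> nth EndS w p = a /\ p.+1 = q.
Proof.
move=> qw; split=> [[_ E /(_ 0)]|[E1 E2]] /=.
  by rewrite addn0 -E addn1 => ->.
by split; rewrite ?addn1 // => -[|//] _; rewrite addn0.
Qed.

Lemma def_seg d u p q : is_proj d p -> is_proj d q ->
  def d (fun x e => seg (enc x) u (p e) (q e)).
Proof.
elim: u d p q => [|a u IH] d p q hp hq.
  apply: (def_ext (R := fun x e => p e = q e)); last by fo.
  by move=> x e _ he hw; rewrite seg_nil // (proj_lt hq he hw).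
apply: (def_ext (R := fun x e => exists m, m < len x /\
  ((nth EndS (enc x) (p e) = a /\ (p e).+1 = m) /\ seg (enc x) u m (q e)))).
  move=> x e _ he hw; rewrite -cat1s seg_cat.
  by split=> -[m [h1 [h2 h3]]]; exists m; do 2!split=> //; apply/(seg1 a (p e) h1).
by fo; apply: IH; proj.
Qed.

Definition all_syms : seq sym := [:: B0; B1; UnitS; NegS; EndS; SepS; HashS].

Lemma def_same d p q : is_proj d p -> is_proj d q ->
  def d (fun x e => nth EndS (enc x) (p e) = nth EndS (enc x) (q e)).
Proof.
move=> hp hq.
apply: (def_ext (R := fun x e => exists a, List.In a all_syms /\
  (nth EndS (enc x) (p e) = a /\ nth EndS (enc x) (q e) = a))).
  move=> x e _ _ _; split=> [[a [_ [-> ->]]]//|<-].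
  by exists (nth EndS (enc x) (p e)); split=> //=; case: (nth _ _ _); auto 10.
by apply: def_exlist => a _; fo.
Qed.
Hint Resolve def_same : definable.

(** Letterwise comparison of two factors matches objects whose codes are unknown when the formula is
    built. *)
Lemma def_copy d p q r t : is_proj d p -> is_proj d q -> is_proj d r -> is_proj d t ->
  def d (fun x e => exists u, seg (enc x) u (p e) (q e) /\ seg (enc x) u (r e) (t e)).
Proof.
move=> hp hq hr ht.
apply: (def_ext (R := fun x e => exists l, l < len x /\ ((p e + l = q e /\ r e + l = t e) /\
  forall j, j < len x -> j < l -> forall a, a < len x -> p e + j = a ->
  forall b, b < len x -> r e + j = b -> nth EndS (enc x) a = nth EndS (enc x) b))); last by fo.
move=> x e hx he hw; have qn := proj_lt hq he hw; have tn := proj_lt ht he hw.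
split=> [[l [ln [[pl rl] h]]]|[u [[_ pu hu] [_ ru hu']]]].
  exists (take l (drop (p e) (enc x))).
  have sz : size (take l (drop (p e) (enc x))) = l by rewrite size_take_min size_drop; lia.
  split; split=> //; rewrite ?sz // => i il; rewrite nth_take // nth_drop //.
  by symmetry; apply: (h i _ il) => //; lia.
exists (size u); split; first by lia.
by split=> // j _ ju a _ <- b _ <-; rewrite hu // hu'.
Qed.

(** * Fields closed by [EndS] and unary numerals *)

Definition field_end (w : seq sym) (p q : nat) : Prop :=
  nth EndS w q = EndS /\ p <= q /\
  forall j, j < size w -> p <= j -> j < q -> ~ nth EndS w j = EndS.

Lemma def_field_end d p q : is_proj d p -> is_proj d q ->
  def d (fun x e => field_end (enc x) (p e) (q e)).
Proof. by move=> hp hq; rewrite /field_end; fo. Qed.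

Lemma field_end_seg w u p q i : i < size w -> seg w (rcons u EndS) p q -> EndS \notin u ->
  field_end w p i <-> i.+1 = q.
Proof.
move=> iw [qw pq h] hu; rewrite size_rcons in pq h.
have hj j : j < size u -> nth EndS w (p + j) <> EndS.
  move=> ju; rewrite h; last by lia.
  by rewrite nth_rcons ju => E; move: hu; rewrite -E mem_nth.
have hE : nth EndS w (p + size u) = EndS by rewrite h ?nth_rcons ?ltnn ?eqxx.
split=> [[E [pi hi]]|E].
  case: (ltngtP i (p + size u)) => c; last by lia.
    by case: (@hj (i - p)); [lia|rewrite subnKC].
  by case: (hi (p + size u)) => //; lia.
have -> : i = p + size u by lia.
split=> //; split; first by lia.
by move=> j jw pj ju; have := @hj (j - p); rewrite subnKC //; apply; lia.
Qed.

Lemma field_end_word w p i : i.+1 < size w -> field_end w p i ->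
  exists2 u : seq sym, EndS \notin u & seg w (rcons u EndS) p i.+1.
Proof.
move=> iw [E [pi hi]]; exists (take (i - p) (drop p w)).
  apply/negP => /(nthP EndS)[j]; rewrite size_take_min size_drop => jl.
  rewrite nth_take; last by lia.
  by rewrite nth_drop; apply: hi; lia.
have sz : size (take (i - p) (drop p w)) = i - p by rewrite size_take_min size_drop; lia.
split=> //; rewrite size_rcons sz; first by lia.
move=> j; rewrite ltnS leq_eqVlt nth_rcons sz => /orP[/eqP->|jp].
  by rewrite ltnn eqxx subnKC.
by rewrite jp nth_take // nth_drop.
Qed.

Definition unary_at (w : seq sym) (p m : nat) : Prop :=
  exists q, q < size w /\ ((p + m = q /\ nth EndS w q = EndS) /\
  forall j, j < size w -> p <= j -> j < q -> nth EndS w j = UnitS).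

Lemma def_unary_at d p m : is_proj d p -> is_proj d m ->
  def d (fun x e => unary_at (enc x) (p e) (m e)).
Proof. by move=> hp hm; rewrite /unary_at; fo. Qed.

End Arithmetic.

#[export] Hint Resolve def_zero def_eq def_one def_suc def_natconst def_le def_lt
  def_add_le def_signed_le def_seg def_same def_copy def_field_end def_unary_at : definable.

(** * Encodings *)

Definition is_bit (a : sym) : bool := (a == B0) || (a == B1).

(** The binary numerals, least significant bit first, with 0 written as the empty word. This
    description of them is first-order. *)
Definition bit_word (u : seq sym) : Prop := all is_bit u /\ (u = [::] \/ last B0 u = B1).

Lemma enc_posE p : all is_bit (enc_pos p) /\ last B0 (enc_pos p) = B1.
Proof.
elim: p => [p [h1 h2]|p [h1 h2]|] //=; split=> //.
by move: h2; case: (enc_pos p).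
Qed.

Lemma enc_natE o : exists2 u : seq sym, bit_word u & enc_nat o = rcons u EndS.
Proof.
rewrite /enc_nat; case: (N.of_nat o) => [|p]; first by exists [::] => //; split=> //; left.
by exists (enc_pos p); rewrite ?cats1 //; have [h1 h2] := enc_posE p; split=> //; right.
Qed.

Lemma bit_word_enc u : bit_word u -> exists o, enc_nat o = rcons u EndS.
Proof.
case=> hb [->|hl]; first by exists 0.
suff [p hp] : exists p, enc_pos p = u.
  by exists (N.to_nat (Npos p)); rewrite /enc_nat N2Nat.id hp cats1.
elim: u hb hl => //= a u IH /andP[ha hb] hl.
case: u IH hb hl => [|b u] IH hb hl.
  by move: hl => /= ->; exists xH.
have [p hp] := IH hb hl.
by case/orP: ha => /eqP ->; [exists (xO p)|exists (xI p)]; rewrite /= hp.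
Qed.

Lemma bit_word_end u : bit_word u -> EndS \notin u.
Proof. by case=> /allP h _; apply/negP => /h. Qed.

(** A letter that closes a code and does not occur inside makes the code prefix-free. Together with
    the leading tags of terms this yields unique parsing of the encodings. *)
Lemma rcons_end_inj u v r r' : EndS \notin u -> EndS \notin v ->
  rcons u EndS ++ r = rcons v EndS ++ r' -> u = v /\ r = r'.
Proof.
elim: u v => [|a u IH] [|b v] //=; rewrite ?inE.
- by move=> _ _ [].
- by move=> _ /norP[/eqP nb _] [].
- by move=> /norP[/eqP nb _] _ [E]; rewrite E in nb.
- move=> /norP[_ hu] /norP[_ hv] [-> E].
  by have [-> ->] := IH v hu hv E.
Qed.

Lemma enc_pos_inj : injective enc_pos.
Proof.
have ne p : enc_pos p <> [::] by case: p.
by elim=> [p IH|p IH|] [q|q|] //= [] => [/IH ->|/ne|/IH ->|/esym/ne].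
Qed.

Lemma enc_nat_inj n m r r' : enc_nat n ++ r = enc_nat m ++ r' -> n = m /\ r = r'.
Proof.
have [u hu En] := enc_natE n; have [v hv Em] := enc_natE m.
rewrite En Em => /(rcons_end_inj (bit_word_end hu) (bit_word_end hv))[uv ->]; split=> //.
move: En Em; rewrite -uv => <-; rewrite /enc_nat => E; apply: Nat2N.inj.
move: E; case: (N.of_nat n) (N.of_nat m) => [|p] [|q] //.
- by have [_] := enc_posE q; case: (enc_pos q) => [|a [|]].
- by have [_] := enc_posE p; case: (enc_pos p) => [|a [|]].
- by rewrite !cats1 => /rcons_inj[/enc_pos_inj ->].
Qed.

Lemma enc_intE z : exists2 u : seq sym, EndS \notin u & enc_int z = rcons u EndS.
Proof.
rewrite /enc_int; case: (z <? 0)%Z.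
  by exists (NegS :: nseq (Z.abs_nat z) UnitS); rewrite ?cats1 // inE mem_nseq /= andbF.
by exists (nseq (Z.abs_nat z) UnitS); rewrite ?cats1 // mem_nseq /= andbF.
Qed.

Lemma enc_int_inj z z' r r' : enc_int z ++ r = enc_int z' ++ r' -> z = z' /\ r = r'.
Proof.
have [u hu E1] := enc_intE z; have [v hv E2] := enc_intE z'.
rewrite E1 E2 => /(rcons_end_inj hu hv)[uv ->]; split=> //.
move: E1 E2; rewrite -uv => <-; rewrite /enc_int.
case: Z.ltb_spec => h1; case: Z.ltb_spec => h2 /=.
- by case=> /(congr1 size); rewrite !size_cat !size_nseq /=; lia.
- by case: (Z.abs_nat z).
- by case: (Z.abs_nat z').
- by move/(congr1 size); rewrite !size_cat !size_nseq /=; lia.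
Qed.

Lemma enc_pred_inj P P' r r' : enc_pred P ++ r = enc_pred P' ++ r' -> P = P' /\ r = r'.
Proof.
case: P P' => [n s e] [n' s' e']; rewrite /enc_pred /= -!catA => /enc_nat_inj[-> E].
have h ss : EndS \notin map enc_sort ss by elim: ss => //= -[] ss IH; rewrite inE.
have E' : rcons (map enc_sort s) EndS ++ (if e then B1 else B0) :: r =
          rcons (map enc_sort s') EndS ++ (if e' then B1 else B0) :: r'.
  by move: E; rewrite -!cats1 -!catA.
have [hs [he ->]] := rcons_end_inj (h s) (h s') E'.
have -> : s = s' by apply: inj_map hs; case=> -[].
by move: he; case: e {E E'}; case: e'.
Qed.

Lemma enc_term_inj t t' r r' : enc_term t ++ r = enc_term t' ++ r' -> t = t' /\ r = r'.
Proof.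
case: t t' => [o|v|z|v k] [o'|v'|z'|v' k'] //= [].
- by move/enc_nat_inj=> [-> ->].
- by move/enc_nat_inj=> [-> ->].
- by move/enc_int_inj=> [-> ->].
- by rewrite -![(enc_nat _ ++ _) ++ _]catA => /enc_nat_inj[-> /enc_int_inj[-> ->]].
Qed.

Lemma enc_atom_inj a a' r r' : enc_atom a ++ r = enc_atom a' ++ r' -> a = a'.
Proof.
case: a a' => [P l] [P' l']; rewrite /enc_atom /= -![(enc_pred _ ++ _) ++ _]catA -![(flatten _ ++ _) ++ _]catA.
move=> /enc_pred_inj[-> E]; congr Atom; elim: l l' E => [|t l IH] [|t' l'] //=.
- by case: t'.
- by case: t.
- by rewrite -![(enc_term _ ++ _) ++ _]catA => /enc_term_inj[-> /IH ->].
Qed.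

Lemma enc_atom_body a :
  exists2 u : seq sym, all (fun s : sym => (s != SepS) && (s != HashS)) u &
  enc_atom a = rcons u SepS /\ u <> [::].
Proof.
pose ok (s : sym) := (s != SepS) && (s != HashS).
have okn n : all ok (enc_nat n).
  have [u [hu _] ->] := enc_natE n; rewrite all_rcons /=.
  by apply: sub_all hu => s /orP[] /eqP ->.
have oki z : all ok (enc_int z).
  rewrite /enc_int !all_cat /= andbT all_nseq orbT andbT.
  by case: ifP.
exists (enc_pred (apred a) ++ flatten (map enc_term (aargs a))); last first.
  split; first by rewrite /enc_atom -cats1 -!catA.
  by rewrite /enc_pred; have [u _ ->] := enc_natE (pname (apred a)); case: u.
rewrite all_cat; apply/andP; split.
  rewrite /enc_pred !all_cat okn /= all_map; apply/andP; split.
    by elim: (psorts _) => //= -[].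
  by case: (pedb _).
elim: (aargs a) => //= t l IH; rewrite all_cat IH andbT.
case: t => [o|v|z|v k]; [exact: (okn o)|exact: (okn v)|exact: (oki z)|].
change (all ok (enc_nat v ++ enc_int k) : Prop).
by rewrite all_cat okn; exact: oki. 
Qed.

(** [SepS] only closes the code of an atom, so a position at the start of the word or right after
    [SepS] begins an atom or the tail, and unique parsing identifies the atom. Elsewhere a suffix of
    a longer code could pass for an atom. *)
Lemma atom_at_start D rest a s q :
  SepS \notin HashS :: rest ->
  s = 0 \/ (0 < s /\ nth EndS (enc_dataset D ++ HashS :: rest) s.-1 = SepS) ->
  seg (enc_dataset D ++ HashS :: rest) (enc_atom a) s q -> List.In a D.
Proof.
move=> hsep; elim: D s q => [|b D IH] s q hs.
  (* With no atom left, the code would have to begin with [HashS], or [SepS] would occur in the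
     tail. *)
  move=> /segP[r1 [r2 [E hr1 _ _]]].
  have [u hu [Ea nu]] := enc_atom_body a.
  case: hs => [s0|[s0 hs]].
    move: E; rewrite (size0nil (eq_trans hr1 s0)) Ea /=.
    by case: u hu nu {Ea} => //= c u /andP[/andP[_ hc] _] _ [E]; rewrite -E in hc.
  move: hsep; rewrite /enc_dataset /= in hs E *; rewrite -hs mem_nth //.
  move/(congr1 size): E; rewrite !size_cat /=; lia.
have [u hu [Eb nu]] := enc_atom_body b.
rewrite /enc_dataset /= -/(enc_dataset D) -catA.
case: (ltnP s (size (enc_atom b))) => sb.
  case: hs => [->|[s0]].
    move=> /segP[r1 [r2 [E /size0nil hr1 _ _]]]; left.
    by move: E; rewrite hr1 /= => /enc_atom_inj.
  rewrite /enc_dataset /= -/(enc_dataset D) -catA nth_cat.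
  have -> : s.-1 < size (enc_atom b) by lia.
  rewrite Eb size_rcons in sb *; rewrite nth_rcons.
  have su : s.-1 < size u by lia.
  rewrite su => E; move/allP: hu => /(_ _ (mem_nth EndS su)).
  by rewrite E eqxx.
move=> [qw sq h]; right; apply: (IH (s - size (enc_atom b)) (q - size (enc_atom b))).
  case: hs => [s0|[s0 hs]]; first by left; lia.
  case: (posnP (s - size (enc_atom b))) => c; [by left|right; split=> //].
  move: hs; rewrite /enc_dataset /= -/(enc_dataset D) -catA nth_cat.
  have -> : (s.-1 < size (enc_atom b)) = false by lia.
  by move=> <-; congr nth; lia.
split; first by move: qw; rewrite size_cat; lia.
- by lia.
- move=> i ia; rewrite -(h i ia) [RHS]nth_cat.
  have -> : (s + i < size (enc_atom b)) = false by lia.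
  by congr nth; lia.
Qed.

Lemma seg_unique w u v p q : seg w u p q -> seg w v p q -> u = v.
Proof.
move=> [_ pu hu] [_ pv hv]; have E : size u = size v by lia.
by apply: (@eq_from_nth _ EndS) => // i iu; rewrite -hu ?hv // -E.
Qed.

Lemma unary_atP w pre a post m : w = pre ++ nseq a UnitS ++ EndS :: post ->
  unary_at w (size pre) m <-> m = a.
Proof.
move=> Ew.
have hU j : j < a -> nth EndS w (size pre + j) = UnitS.
  move=> ja; rewrite Ew nth_cat ltnNge leq_addr /= addKn nth_cat size_nseq ja.
  by rewrite nth_nseq ja.
have hE : nth EndS w (size pre + a) = EndS.
  by rewrite Ew nth_cat ltnNge leq_addr /= addKn nth_cat size_nseq ltnn subnn.
have sw : size w = size pre + (a + (size post).+1) by rewrite Ew !size_cat size_nseq.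
split=> [[q [qw [[pm E] h]]]|->].
  case: (ltngtP m a) => // c.
    by move: (hU m c); rewrite pm E.
  by move: (h (size pre + a)); rewrite hE => h'; suff: EndS = UnitS by []; apply: h'; lia.
exists (size pre + a); split; first by lia.
do !split=> //; move=> j jw pj ja.
by have := hU (j - size pre); rewrite subnKC //; apply; lia.
Qed.

(** [signed false 0] is zero too, and zero is written without [NegS]; hence the separate case
    [m = 0]. *)
Definition int_at (s : bool) (w : seq sym) (p m : nat) : Prop :=
  if s then unary_at w p m
  else (m = 0 /\ unary_at w p m) \/
       (~ m = 0 /\ (nth EndS w p = NegS /\
                    exists p', p' < size w /\ (p.+1 = p' /\ unary_at w p' m))).

Lemma int_atP s w pre z post m : w = pre ++ enc_int z ++ post ->
  int_at s w (size pre) m <-> z = signed s m.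
Proof.
rewrite /enc_int; case: Z.ltb_spec => hz Ew.
- have hn : nth EndS w (size pre) = NegS by rewrite Ew nth_cat ltnn subnn.
  have nu k : ~ unary_at w (size pre) k.
    move=> [q [qw [[pm E] h]]].
    case: (ltnP (size pre) q) => pq; last first.
      have qE : q = size pre by lia.
      by rewrite qE hn in E.
    by have := h (size pre); rewrite hn => h'; suff: NegS = UnitS by []; apply: h' => //; lia.
  have hu k : unary_at w (size pre).+1 k <-> k = Z.abs_nat z.
    rewrite -(size_rcons pre NegS); apply: (@unary_atP _ _ _ post).
    by rewrite Ew -cats1 -!catA.
  have sw : (size pre).+1 < size w.
    by rewrite Ew !size_cat size_nseq /=; lia.
  case: s; rewrite /int_at /signed.
    by split=> [/nu|]; [|lia].
  split=> [[[_ /nu]//|[m0 [_ [p' [_ [<- /hu ->]]]]]]|E]; first by lia.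
  right; split; first by lia.
  by split=> //; exists (size pre).+1; do 2!split=> //; apply/hu; lia.
- have hu k : unary_at w (size pre) k <-> k = Z.abs_nat z.
    by apply: (@unary_atP _ _ _ post); rewrite Ew /= -!catA.
  case: s; rewrite /int_at /signed; first by rewrite hu; lia.
  split=> [[[-> /hu]|[m0 [E _]]]|E]; first by lia.
  + move: E; rewrite Ew nth_cat ltnn subnn /=.
    by case: (Z.abs_nat z).
  + by left; split; [lia|apply/hu; lia].
Qed.

(** * Descriptors of values *)

Lemma enc_instance_gt0 x : DTP_instance x -> 0 < size (enc_instance x).
Proof. by case: x => -[D tin] tout _; rewrite /enc_instance !size_cat /=; lia. Qed.

#[export] Hint Resolve enc_instance_gt0 : definable.

Section Descriptors.

Notation inst := (dataset * Z * Z)%type.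
Notation def := (def enc_instance DTP_instance).
Notation word x := (enc_instance x).
Notation len x := (size (enc_instance x)).

(** Any closed binary numeral counts, even a suffix of another one or a part of a predicate. The
    surplus only enlarges the range of the object quantifiers, which has to include the objects of
    the data. *)
Definition objpos (x : inst) (i : nat) : Prop := exists o q, seg (word x) (enc_nat o) i q.

Definition objraw (x : inst) (i : nat) : nat :=
  epsilon (inhabits 0) (fun o => exists q, seg (word x) (enc_nat o) i q).

Lemma objraw_seg x i o q : seg (word x) (enc_nat o) i q -> objraw x i = o.
Proof.
move=> h.
have [q' h'] : exists q', seg (word x) (enc_nat (objraw x i)) i q'.
  by apply: (epsilon_spec (inhabits 0) (fun o => exists q, seg (word x) (enc_nat o) i q)); exists o, q.
move/segP: h => [r1 [r2 [E1 s1 _ _]]]; move/segP: h' => [r3 [r4 [E2 s2 _ _]]].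
have : r3 ++ enc_nat (objraw x i) ++ r4 = r1 ++ enc_nat o ++ r2 by rewrite -E1 -E2.
by move/eqP; rewrite eqseq_cat ?s1 ?s2 // => /andP[_ /eqP /enc_nat_inj[]].
Qed.

Variable consts : seq nat.

(* An object that is neither in the data nor among the constants; it is the
   value of the positions at which no object is written. *)
Definition star (x : inst) : nat :=
  (\max_(i < len x) objraw x i + \max_(c <- consts) c).+1.

Definition objat (x : inst) (i : nat) : nat :=
  if excluded_middle_informative (objpos x i) then objraw x i else star x.

Lemma objat_seg x i o q : seg (word x) (enc_nat o) i q -> objat x i = o.
Proof.
move=> h; rewrite /objat; case: (excluded_middle_informative _) => ho.
  exact: objraw_seg h.
by case: ho; exists o, q.
Qed.

Lemma objat_spec x i : objpos x i -> exists q, seg (word x) (enc_nat (objat x i)) i q.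
Proof. by case=> o [q h]; exists q; rewrite (objat_seg h). Qed.

Lemma objat_star x i : i < len x -> objat x i = star x <-> ~ objpos x i.
Proof.
move=> ix; rewrite /objat; case: (excluded_middle_informative _) => h; split=> //.
have : objraw x i <= \max_(i < len x) objraw x i.
  exact: (leq_bigmax (F := fun i : 'I_(len x) => objraw x i) (Ordinal ix)).
by rewrite /star /= => le E; exfalso; lia.
Qed.

Lemma star_const x c : c \in consts -> c <> star x.
Proof.
move=> hc; have : c <= \max_(c <- consts) c by exact: (leq_bigmax_seq (F := id)).
by rewrite /star; lia.
Qed.

Lemma def_objpos d p : is_proj d p -> def d (fun x e => objpos x (p e)).
Proof.
move=> hp.
apply: (def_ext (R := fun x e => exists i, i < len x /\ (field_end (word x) (p e) i /\
  ((exists q, q < len x /\ i.+1 = q) /\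
   ((forall j, j < len x -> p e <= j -> j < i ->
       nth EndS (word x) j = B0 \/ nth EndS (word x) j = B1) /\
   (p e = i \/ exists l, l < len x /\ (p e <= l /\ (l.+1 = i /\ nth EndS (word x) l = B1)))))))); last by fo.
move=> x e hx he hw; split.
  move=> [i [ix [fe [[q [qx iq]] [hb hl]]]]]; rewrite -iq in qx.
  have [u hu sgu] := field_end_word qx fe.
  have sz : p e + size u = i by case: sgu => _; rewrite size_rcons addnS => -[].
  have hn j : j < size u -> nth EndS u j = nth EndS (word x) (p e + j).
    by move=> ju; case: sgu => _ _ ->; rewrite ?nth_rcons ?ju // size_rcons; lia.
  have [o ho] : exists o, enc_nat o = rcons u EndS.
    apply: bit_word_enc; split.
      apply/allP => s /(nthP EndS)[j ju' <-]; have ju : j < size u := ju'; rewrite hn //.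
      by case: (hb (p e + j)) => [||| ->|->] //; lia.
    case: hl => [E|[l [lx [pl [li E]]]]]; first by left; apply: size0nil; lia.
    have u0 : 0 < size u by lia.
    right; rewrite (last_nth EndS) -[B0 :: u]cat1s nth_cat /=.
    by rewrite ltnNge u0 /= hn; [rewrite -E; congr nth; lia|lia].
  by exists o, i.+1; rewrite ho.
move=> [o [q]]; have [u hu ->] := enc_natE o => sgu.
have [qx pq hn] := sgu; rewrite size_rcons in pq hn.
exists (p e + size u); split; first by lia.
have ux : p e + size u < len x by lia.
split; first by apply/(field_end_seg ux sgu (bit_word_end hu)); lia.
split; first by exists q; lia.
have hn' j : j < size u -> nth EndS (word x) (p e + j) = nth EndS u j.
  by move=> ju; rewrite hn ?nth_rcons ?ju //; lia.
have [/allP ha hl] := hu; split.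
  move=> j jx pj ji; have ju : j - p e < size u by lia.
  have := hn' (j - p e) ju; rewrite subnKC // => ->.
  by case/orP: (ha _ (mem_nth EndS ju)) => /eqP ->; [left|right].
case: hl => [->|hl]; first by left; rewrite addn0.
have u0 : 0 < size u by case: (u) hl.
right; exists (p e + size u).-1; split; first by lia.
do 2?[split; first by lia].
have -> : (p e + size u).-1 = p e + (size u).-1 by lia.
by rewrite hn' ?nth_last; [case: (u) hl u0|lia].
Qed.
Hint Resolve def_objpos : definable.

Lemma def_seg_objat d i p q : is_proj d i -> is_proj d p -> is_proj d q ->
  def d (fun x e => objpos x (i e) /\ seg (word x) (enc_nat (objat x (i e))) (p e) (q e)).
Proof.
move=> hi hp hq.
apply: (def_ext (R := fun x e => objpos x (i e) /\ exists j, j < len x /\ exists k, k < len x /\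
  (field_end (word x) (i e) j /\ (j.+1 = k /\
   exists u, seg (word x) u (i e) k /\ seg (word x) u (p e) (q e)))));
  last by fo.
move=> x e hx he hw; split=> -[ho].
  move=> [j [jx [k [kx [fe [jk [u [h1 h2]]]]]]]]; split=> //.
  have [r hr] := objat_spec ho; have [v hv Ev] := enc_natE (objat x (i e)).
  rewrite Ev in hr *; have kr := (field_end_seg jx hr (bit_word_end hv)).1 fe.
  rewrite -kr jk in hr.
  by rewrite (seg_unique hr h1).
move=> h; split=> //.
have [r hr] := objat_spec ho; have [v hv Ev] := enc_natE (objat x (i e)).
rewrite Ev in hr h; have [rx ir _] := hr; rewrite size_rcons in ir.
have jx : r.-1 < len x by lia.
have jr : r.-1.+1 = r by lia.
exists r.-1; split=> //; exists r; split=> //; split; last by split=> //; exists (rcons v EndS).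
exact/(field_end_seg jx hr (bit_word_end hv)).
Qed.

(** The anchors of times: 0 for the time constants of the program, [tout] for the goal, [tin] for
    the border of the future. *)
Inductive tbase := BZero | BIn | BOut.

Definition bval (x : inst) (b : tbase) : Z :=
  match b with BZero => 0 | BIn => x.1.2 | BOut => x.2 end%Z.

Lemma enc_dataset_hash D : HashS \notin enc_dataset D.
Proof.
elim: D => // a D IH; rewrite /enc_dataset /= mem_cat negb_or IH andbT.
have [u hu [-> _]] := enc_atom_body a; rewrite mem_rcons inE /=.
by apply/negP => /(allP hu).
Qed.

Lemma enc_int_plain z s : s \in enc_int z -> s \in [:: NegS; UnitS; EndS].
Proof.
rewrite /enc_int !mem_cat mem_nseq.
by case: ifP => _; case: s; rewrite !inE /= ?andbF.
Qed.

Lemma hash_pos x h : h < len x -> nth EndS (word x) h = HashS <-> h = size (enc_dataset x.1.1).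
Proof.
case: x => -[D tin] tout /= hx; split=> [|->]; last by rewrite nth_cat ltnn subnn.
rewrite nth_cat; case: ltnP => c E.
  by move: (enc_dataset_hash D); rewrite -E mem_nth.
case E' : (h - size (enc_dataset D)) E => [|k] /=; first by lia.
have kk : k < size (enc_int tin ++ enc_int tout) by move: hx; rewrite size_cat /=; lia.
move=> E; have := mem_nth EndS kk; rewrite E mem_cat.
by case/orP => /enc_int_plain.
Qed.

Lemma def_int_at s d p m : is_proj d p -> is_proj d m ->
  def d (fun x e => int_at s (word x) (p e) (m e)).
Proof. by move=> hp hm; rewrite /int_at; case: s; fo. Qed.
Hint Resolve def_int_at : definable.

(** [tin] is written right after the unique [HashS], and [tout] after the [EndS] that closes
    [tin]. *)
Lemma def_bval d b s m : is_proj d m -> def d (fun x e => bval x b = signed s (m e)).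
Proof.
move=> hm; case: b.
- apply: (def_ext (R := fun x e => m e = 0)); last by fo.
  by move=> x e _ _ _; rewrite /signed /=; case: s; lia.
- apply: (def_ext (R := fun x e => exists h, h < len x /\ (nth EndS (word x) h = HashS /\
    exists r, r < len x /\ (h.+1 = r /\ int_at s (word x) r (m e))))); last by fo.
  move=> [[D tin] tout] e hx he hw; rewrite [bval _ _]/=.
  set w := enc_instance _; have Ew : w = rcons (enc_dataset D) HashS ++ enc_int tin ++ enc_int tout.
    by rewrite cat_rcons.
  have H := int_atP s (m e) Ew; rewrite size_rcons in H.
  split=> [[h [hw' [/hash_pos -> // [r [rw [<- /H]]]]]]//|/H h].
  have sw : (size (enc_dataset D)).+1 < size w.
    have [u _ Eu] := enc_intE tin.
    by rewrite Ew Eu !size_cat !size_rcons; lia.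
  exists (size (enc_dataset D)); split; first by lia.
  have hD : size (enc_dataset D) < size w by lia.
  by split; [exact/(hash_pos hD)|exists (size (enc_dataset D)).+1].
- apply: (def_ext (R := fun x e => exists h, h < len x /\ (nth EndS (word x) h = HashS /\
    exists r, r < len x /\ (h.+1 = r /\ exists i, i < len x /\ (field_end (word x) r i /\
    exists t, t < len x /\ (i.+1 = t /\ int_at s (word x) t (m e))))))); last by fo.
  move=> [[D tin] tout] e hx he hw; rewrite [bval _ _]/=.
  set w := enc_instance _.
  have Ew : w = (rcons (enc_dataset D) HashS ++ enc_int tin) ++ enc_int tout ++ [::].
    by rewrite cats0 cat_rcons -catA.
  have H := int_atP s (m e) Ew; rewrite size_cat size_rcons in H.
  have [u hu Eu] := enc_intE tin; have [v _ Ev] := enc_intE tout.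
  have sg : seg w (rcons u EndS) (size (enc_dataset D)).+1 ((size (enc_dataset D)).+1 + size (enc_int tin)).
    apply/segP; exists (rcons (enc_dataset D) HashS), (enc_int tout).
    by rewrite -Eu Ew cats0 -catA size_rcons Ev size_rcons.
  have sw : (size (enc_dataset D)).+1 + size (enc_int tin) < size w by case: sg.
  have F i iw := field_end_seg (i := i) iw sg hu.
  split.
    move=> [h [hw' [/hash_pos -> // [r [rw [<- [i [iw [/F-> // [t [_ [<- h']]]]]]]]]]]].
    by apply/H; move: h'.
  move/H => h.
  have := F ((size (enc_dataset D)).+1 + size (enc_int tin)).-1; rewrite Eu size_rcons in h sw *.
  move=> F'.
  exists (size (enc_dataset D)); split; first by lia.
  have hD : size (enc_dataset D) < size w by lia.
  split; first by apply/(hash_pos hD).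
  exists (size (enc_dataset D)).+1; split; first by lia.
  split=> //; exists ((size (enc_dataset D)).+1 + size u); split; first by lia.
  split; first by move: F'; rewrite addnS /= => -> //; lia.
  by exists ((size (enc_dataset D)).+1 + size u).+1; rewrite -addnS.
Qed.
Hint Resolve def_bval : definable.
Lemma enc_int_size z : Z.abs_nat z < size (enc_int z).
Proof. by rewrite /enc_int !size_cat size_nseq /=; lia. Qed.

(** This rests on the unary encoding: a head position can hold the absolute value of an input
    time. *)
Lemma bval_lt x b : DTP_instance x -> Z.abs_nat (bval x b) < len x.
Proof.
move=> hx; case: b => /=; first exact: enc_instance_gt0.
all: case: x {hx} => -[D tin] tout; have := enc_int_size tin; have := enc_int_size tout.
all: rewrite /enc_instance /=; move: (enc_int tin) (enc_int tout) => u v.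
all: by rewrite !size_cat /= size_cat; lia.
Qed.

Lemma signed_abs z : exists s, z = signed s (Z.abs_nat z).
Proof. by exists (0 <=? z)%Z; rewrite /signed; case: Z.leb_spec; lia. Qed.

Lemma in_bools (s : bool) : List.In s [:: true; false].
Proof. by case: s => /=; auto. Qed.

Lemma def_bval_le d b k b' :
  def d (fun x e => (bval x b + k <= bval x b')%Z).
Proof.
apply: (def_ext (R := fun x e => exists m, m < len x /\ exists m', m' < len x /\
  exists s, List.In s [:: true; false] /\ exists s', List.In s' [:: true; false] /\
  (bval x b = signed s m /\ (bval x b' = signed s' m' /\
   (signed s m + k <= signed s' m')%Z)))).
  move=> x e hx _ _; split=> [[m [_ [m' [_ [s [_ [s' [_ [-> [->]]]]]]]]]]//|h].
  exists (Z.abs_nat (bval x b)); split; first exact: bval_lt.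
  exists (Z.abs_nat (bval x b')); split; first exact: bval_lt.
  have [s hs] := signed_abs (bval x b); have [s' hs'] := signed_abs (bval x b').
  exists s; split; first exact: in_bools.
  by exists s'; split; [exact: in_bools|rewrite -hs -hs'].
fo; apply: def_exlist => s _; apply: def_exlist => s' _.
by fo; apply: (def_signed_le _ _ s _ s'); proj.
Qed.

Lemma def_bval_eq d b k b' k' :
  def d (fun x e => (bval x b + k = bval x b' + k')%Z).
Proof.
apply: (def_ext _ (def_and (def_bval_le d b (k - k') b') (def_bval_le d b' (k' - k) b))).
by move=> x e _ _ _; lia.
Qed.

Lemma def_bval_shift d b k s m : is_proj d m ->
  def d (fun x e => (bval x b + k = signed s (m e))%Z).
Proof.
move=> hm.
apply: (def_ext (R := fun x e => exists m1, m1 < len x /\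
  exists s1, List.In s1 [:: true; false] /\ (bval x b = signed s1 m1 /\
   ((signed s1 m1 + k <= signed s (m e))%Z /\ (signed s (m e) + - k <= signed s1 m1)%Z)))).
  move=> x e hx _ _; split=> [[m1 [_ [s1 [_ [->]]]]]|h]; first by lia.
  exists (Z.abs_nat (bval x b)); split; first exact: bval_lt.
  have [s1 hs1] := signed_abs (bval x b).
  by exists s1; split; [exact: in_bools|rewrite -hs1; lia].
fo; apply: def_exlist => s1 _; fo.
Qed.
Hint Resolve def_bval_shift : definable.

Lemma seg_unary w m p q : seg w (nseq m UnitS ++ [:: EndS]) p q <->
  q < size w /\ ((p + m).+1 = q /\ unary_at w p m).
Proof.
split=> [h|[qw [pm [r [rw [[pr E] h]]]]]].
  move/segP: (h) => [r1 [r2 [Ew sr _ _]]].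
  have [qw pq _] := h; rewrite size_cat size_nseq /= addn1 addnS in pq.
  do 2?split=> //; rewrite -sr; apply/(@unary_atP _ _ m r2) => //.
  by rewrite Ew -catA.
split=> //; first by rewrite size_cat size_nseq /=; lia.
move=> i; rewrite size_cat size_nseq /= addn1 ltnS leq_eqVlt nth_cat size_nseq.
case/orP => [/eqP->|im]; first by rewrite ltnn subnn pr.
by rewrite im nth_nseq im; apply: h; lia.
Qed.

(** A shifted time may exceed the input length, but then its numeral is not a factor of the word; so
    it suffices to seek the magnitude [m] among the positions. *)
Lemma def_seg_time d b k p q : is_proj d p -> is_proj d q ->
  def d (fun x e => seg (word x) (enc_int (bval x b + k)) (p e) (q e)).
Proof.
move=> hp hq.
apply: (def_ext (R := fun x e => exists m, m < len x /\
  (((bval x b + k = signed true m)%Z /\ exists r, r < len x /\ (p e + m = r /\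
      (r.+1 = q e /\ unary_at (word x) (p e) m))) \/
   (~ m = 0 /\ ((bval x b + k = signed false m)%Z /\ exists p', p' < len x /\
     ((nth EndS (word x) (p e) = NegS /\ (p e).+1 = p') /\ exists r, r < len x /\ (p' + m = r /\
      (r.+1 = q e /\ unary_at (word x) p' m)))))))); last by fo.
move=> x e hx he hw; have qx := proj_lt hq he hw.
have En z : (0 <= z)%Z -> enc_int z = nseq (Z.abs_nat z) UnitS ++ [:: EndS].
  by rewrite /enc_int; case: Z.ltb_spec => //; lia.
have Ep z : (z < 0)%Z -> enc_int z = [:: NegS] ++ (nseq (Z.abs_nat z) UnitS ++ [:: EndS]).
  by rewrite /enc_int; case: Z.ltb_spec => //; lia.
split.
  move=> [m [_ [[Ez [r [_ [pr [rq hu]]]]]|[m0 [Ez [p' [p'x [hneg [r [_ [pr [rq hu]]]]]]]]]]]].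
    rewrite Ez /signed En ?Zabs2Nat.id; last by lia.
    by apply/seg_unary; rewrite pr.
  rewrite Ez /signed Ep; last by lia.
  have -> : Z.abs_nat (- Z.of_nat m) = m by lia.
  apply/seg_cat; exists p'; split=> //; split; first exact/seg1.
  by apply/seg_unary; rewrite pr.
case: (Z.ltb_spec (bval x b + k) 0) => hz.
  rewrite Ep // => /seg_cat[p' [p'x [/(seg1 _ _ p'x) hneg /seg_unary[_ [pq hu]]]]].
  exists (Z.abs_nat (bval x b + k)); split; first by lia.
  right; split; first by lia.
  split; first by rewrite /signed; lia.
  exists p'; split=> //; split=> //.
  by exists (p' + Z.abs_nat (bval x b + k)); split; [lia|].
rewrite En // => /seg_unary[_ [pq hu]].
exists (Z.abs_nat (bval x b + k)); split; first by lia.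
left; split; first by rewrite /signed; lia.
by exists (p e + Z.abs_nat (bval x b + k)); split; [lia|].
Qed.
Hint Resolve def_seg_time : definable.

(* What is known of a value when the formula is built: [DPos i] is the object
   written at the position of head [i]. *)
Inductive desc := DConst of nat | DPos of nat | DTime of tbase & Z.

Definition val (x : inst) (e : seq nat) (a : desc) : nat + Z :=
  match a with
  | DConst c => inl c
  | DPos i => inl (objat x (nth 0 e i))
  | DTime b k => inr (bval x b + k)%Z
  end.

Definition desc_ok (d : nat) (a : desc) : Prop :=
  match a with
  | DConst c => c \in consts
  | DPos i => i < d
  | DTime _ _ => True
  end.

Definition term_of (v : nat + Z) : term :=
  match v with inl o => OConst o | inr z => TConst z end.

Lemma desc_ok_widen d d' a : d <= d' -> desc_ok d a -> desc_ok d' a.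
Proof. by move=> dd'; case: a => //= i; move/leq_trans; apply. Qed.

Lemma val_take d x e a : desc_ok d a -> val x (take d e) a = val x e a.
Proof. by case: a => //= i id; rewrite nth_take. Qed.

Definition no_star (x : inst) (vs : seq (nat + Z)) : Prop :=
  List.Forall (fun v => v <> inl (star x)) vs.

Definition enc_vals (vs : seq (nat + Z)) : seq sym := flatten [seq enc_term (term_of v) | v <- vs].

Lemma seg_cons w a u p q :
  seg w (a :: u) p q <-> exists m, m < size w /\ ((nth EndS w p = a /\ p.+1 = m) /\ seg w u m q).
Proof.
rewrite -cat1s seg_cat; split=> -[m [mw [h1 h2]]]; exists m; do 2?split=> //; exact/(seg1 _ _ mw).
Qed.

(** [star] is written nowhere, so there is no code to copy and it is excluded explicitly. By
    [edb_data_no_star] this loses no fact of the data. *)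
Lemma def_seg_val d a p q : desc_ok d a -> is_proj d p -> is_proj d q ->
  def d (fun x e => val x e a <> inl (star x) /\
                    seg (word x) (enc_term (term_of (val x e a))) (p e) (q e)).
Proof.
move=> ha hp hq; case: a ha => [c hc|i hi|b k _] /=.
- apply: (def_ext (R := fun x e => seg (word x) (B0 :: enc_nat c) (p e) (q e))); last by fo.
  move=> x e _ _ _; split=> [|[]//] h; split=> // -[]; exact: star_const.
- apply: (def_ext (R := fun x e => exists m, m < len x /\ ((nth EndS (word x) (p e) = B0 /\
      (p e).+1 = m) /\ (objpos x (nth 0 e i) /\
      seg (word x) (enc_nat (objat x (nth 0 e i))) m (q e))))).
    move=> x e _ he hw; have ix : nth 0 e i < len x by apply: hw; rewrite he.
    split=> [[m [mx [h1 [h2 h3]]]]|[hn /seg_cons[m [mx [h1 h2]]]]].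
      split; last by apply/seg_cons; exists m.
      by move=> [/(objat_star ix)].
    exists m; do 2?split=> //; split=> //; apply: NNPP => /(objat_star ix) E.
    by apply: hn; rewrite E.
  have {}hi : i < d by exact: hi.
  apply: def_ex; apply: def_and; first by fo.
  apply: (def_ext _ (@def_seg_objat d.+1 (fun e => nth 0 e i) (fun e => nth 0 e d)
     (fun e => q (take d e)) _ _ _)); try proj.
  by move=> x e _ _ _; rewrite nth_take.
- apply: (def_ext (R := fun x e => exists m, m < len x /\ ((nth EndS (word x) (p e) = B1 /\
      (p e).+1 = m) /\ seg (word x) (enc_int (bval x b + k)) m (q e)))); last by fo.
  by move=> x e _ _ _; split=> [h|[_ h]]; [split=> //|]; apply/seg_cons.
Qed.

Lemma def_seg_vals d l p q : List.Forall (desc_ok d) l -> is_proj d p -> is_proj d q ->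
  def d (fun x e => no_star x (map (val x e) l) /\
                    seg (word x) (enc_vals (map (val x e) l)) (p e) (q e)).
Proof.
elim: l d p q => [|a l IH] d p q hl hp hq.
  apply: (def_ext (R := fun x e => p e = q e)); last by fo.
  move=> x e hx he hw; have qx := proj_lt hq he hw.
  by rewrite (seg_nil _ qx); split=> [|[]//]; split=> //; constructor.
have ha : desc_ok d a by inversion hl.
have {}hl : List.Forall (desc_ok d) l by inversion hl.
have hw d' : d <= d' -> List.Forall (desc_ok d') l.
  by move=> dd'; apply: List.Forall_impl hl => b; apply: desc_ok_widen.
apply: (def_ext (R := fun x e => exists m, m < len x /\
   ((val x e a <> inl (star x) /\ seg (word x) (enc_term (term_of (val x e a))) (p e) m) /\
    (no_star x (map (val x e) l) /\ seg (word x) (enc_vals (map (val x e) l)) m (q e))))).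
  move=> x e _ _ _; rewrite /enc_vals /= seg_cat.
  split=> [[m [mx [[h1 h2] [h3 h4]]]]|[h1 [m [mx [h2 h3]]]]].
    by split; [constructor|exists m].
  by exists m; inversion h1.
apply: def_ex; apply: def_and.
  apply: (def_ext _ (@def_seg_val d.+1 a (fun e => p (take d e)) (fun e => nth 0 e d) _ _ _));
    try proj; last by apply: desc_ok_widen ha.
  by move=> x e _ _ _; rewrite val_take.
apply: (def_ext _ (IH d.+1 (fun e => nth 0 e d) (fun e => q (take d e)) _ _ _)); try proj;
  last by apply: hw.
move=> x e _ _ _; suff -> : map (val x (take d e)) l = map (val x e) l by [].
apply: List.map_ext_in => b hb; apply: (val_take (d := d)).
by move/List.Forall_forall: hl; apply.
Qed.

(** * Facts of the data and conceivable facts of the future *)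

Definition edb_data (x : inst) (P : Defs.pred) (vs : seq (nat + Z)) : Prop :=
  List.In (Atom P (map term_of vs)) x.1.1.

Lemma enc_dataset_cat D D' : enc_dataset (D ++ D') = enc_dataset D ++ enc_dataset D'.
Proof. by rewrite /enc_dataset map_cat flatten_cat. Qed.

Lemma in_dataset_seg x a : List.In a x.1.1 -> exists s q,
  (s = 0 \/ exists s', s'.+1 = s /\ nth EndS (word x) s' = SepS) /\ seg (word x) (enc_atom a) s q.
Proof.
case: x => -[D tin] tout; rewrite [_.1.1]/= => h; have [D1 [D2 ->]] := List.in_split _ _ h.
exists (size (enc_dataset D1)), (size (enc_dataset D1) + size (enc_atom a)).
have Ew : enc_instance (D1 ++ a :: D2, tin, tout) =
  enc_dataset D1 ++ enc_atom a ++ (enc_dataset D2 ++ HashS :: enc_int tin ++ enc_int tout).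
  by rewrite /enc_instance -cat1s !enc_dataset_cat {2}/enc_dataset /= cats0 -!catA.
split; last by apply/segP; eexists; eexists; split; first exact: Ew; rewrite ?size_cat /=; lia.
case/lastP: D1 Ew => [|D1 b] Ew; [by left|right].
have [u _ [Eb _]] := enc_atom_body b.
have Eu : enc_dataset (rcons D1 b) = rcons (enc_dataset D1 ++ u) SepS.
  by rewrite -cats1 enc_dataset_cat {2}/enc_dataset /= cats0 Eb rcons_cat.
exists (size (enc_dataset D1 ++ u)); rewrite Ew Eu size_rcons; split=> //.
by rewrite nth_cat size_rcons ltnSn nth_rcons ltnn eqxx.
Qed.

Lemma data_objpos x P args o : List.In (Atom P args) x.1.1 -> List.In (OConst o) args ->
  exists i, [/\ i < len x, objpos x i & objat x i = o].
Proof.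
move=> /in_dataset_seg[s [q [_]]].
rewrite /enc_atom /= => /seg_cat[m1 [_ [_ /seg_cat[m2 [_ [h _]]]]]].
elim: args m1 h => //= t args IH m1 /seg_cat[m [mx [h1 h2]]] [E|]; last exact: IH h2.
move: h1; rewrite E /= => /seg_cons[i [ix [_ h]]].
by exists i; split=> //; [exists o, m|apply: objat_seg h].
Qed.

Lemma edb_data_no_star x P vs : edb_data x P vs -> no_star x vs.
Proof.
move=> h; apply/List.Forall_forall => v hv E.
have [|i [ix ip E']] := @data_objpos x P _ (star x) h.
  by apply/List.in_map_iff; exists v; split=> //; rewrite E.
by move/(objat_star ix): E'.
Qed.

(** Membership in the data is an occurrence of the code at the start of the word or right after
    [SepS]; [atom_at_start] and [in_dataset_seg] are the two directions. *)
Lemma def_edb_data d P l : List.Forall (desc_ok d) l ->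
  def d (fun x e => edb_data x P (map (val x e) l)).
Proof.
move=> hl.
apply: (def_ext (R := fun x e => exists s, s < len x /\ exists q, q < len x /\
  exists m1, m1 < len x /\ exists m2, m2 < len x /\
  ((s = 0 \/ exists s', s' < len x /\ (s'.+1 = s /\ nth EndS (word x) s' = SepS)) /\
   (seg (word x) (enc_pred P) s m1 /\
    (seg (word x) [:: SepS] m2 q /\
     (no_star x (map (val x e) l) /\ seg (word x) (enc_vals (map (val x e) l)) m1 m2)))))).
  move=> x e hx he hw.
  have Ea vs : enc_atom (Atom P (map term_of vs)) = enc_pred P ++ enc_vals vs ++ [:: SepS].
    by rewrite /enc_atom /enc_vals /= -map_comp.
  split.
    move=> [s [sx [q [qx [m1 [m1x [m2 [m2x [hs [h1 [h2 [hn h3]]]]]]]]]]]].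
    have sg : seg (word x) (enc_atom (Atom P (map term_of (map (val x e) l)))) s q.
      by rewrite Ea; apply/seg_cat; exists m1; split=> //; split=> //; apply/seg_cat; exists m2.
    move: hs sg; case: (x) => -[D tin] tout /= hs sg.
    apply: (atom_at_start _ _ sg) => /=.
      rewrite inE mem_cat negb_or /=; apply/negP.
      by case/orP => /enc_int_plain.
    by case: hs => [->|[s' [_ [<- E]]]]; [left|right].
  move=> h; have hn := edb_data_no_star h.
  have [s [q [hs]]] := in_dataset_seg h.
  rewrite Ea => /seg_cat[m1 [m1x [h1 /seg_cat[m2 [m2x [h3 h2]]]]]].
  have qx : q < len x by case: h2.
  have sm : s <= m1 by case: h1 => _ <- _; lia.
  exists s; split; first by lia.
  exists q; split=> //; exists m1; split=> //; exists m2; split=> //; split; last by [].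
  case: hs => [|[s' [E E']]]; [by left|right; exists s'; split=> //; lia].
do 4![apply: def_ex]; do 3![apply: def_and; first by fo].
have hl4 : List.Forall (desc_ok d.+4) l.
  by apply: List.Forall_impl hl => a; apply: desc_ok_widen; lia.
apply: (def_ext _ (@def_seg_vals d.+4 l (fun e => nth 0 e d.+2) (fun e => nth 0 e d.+3) hl4 _ _));
  try proj.
move=> x e _ _ _; rewrite nth_take //.
suff -> : map (val x (take d (take d.+1 (take d.+2 (take d.+3 e))))) l = map (val x e) l by [].
apply: List.map_ext_in => b hb.
have ok : desc_ok d b by move/List.Forall_forall: hl; apply.
by rewrite !(val_take (d := _)) //; apply: desc_ok_widen ok; lia.
Qed.

Definition future (x : inst) (P : Defs.pred) (vs : seq (nat + Z)) : Prop :=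
  pedb P = true /\ exists ss, [/\ psorts P = rcons ss STime, all is_obj_sort ss &
  exists os z, [/\ size os = size ss, vs = rcons (map inl os) (inr z) & (x.1.2 < z)%Z]].

Definition edb_future (x : inst) (P : Defs.pred) (vs : seq (nat + Z)) : Prop :=
  edb_data x P vs \/ future x P vs.

Definition is_odesc (a : desc) : bool := if a is DTime _ _ then false else true.

Lemma odescs_val x e l : all is_odesc l -> exists2 os, size os = size l & map (val x e) l = map inl os.
Proof.
elim: l => [|a l IH]; first by exists [::].
move=> /= /andP[ha /IH[os so ->]].
by case: a ha => [c _|i _|//]; eexists (_ :: os); rewrite /= ?so.
Qed.

Lemma val_odescs x e l os : map (val x e) l = map inl os -> all is_odesc l /\ size os = size l.
Proof. by elim: l os => [|[c|i|b k] l IH] [|o os] //= [_ /IH[-> ->]]. Qed.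

(** The predicate and the shape of [l] are known when the formula is built; only the comparison of
    the last time with [tin] depends on the input. *)
Lemma def_future d P l : def d (fun x e => future x P (map (val x e) l)).
Proof.
case: (classic (pedb P = true /\ exists ss, [/\ psorts P = rcons ss STime, all is_obj_sort ss &
  exists l' b k, [/\ l = rcons l' (DTime b k), all is_odesc l' & size l' = size ss]])); last first.
  move=> no; apply: (def_ext _ (def_const _ _ d False)) => x e _ _ _; split=> // h; apply: no.
  case: h => hP [ss [h1 h2 [os [z [h3 h4 _]]]]]; split=> //; exists ss; split=> //.
  case/lastP: l h4 => [|l a]; first by case: (os).
  rewrite map_rcons => /rcons_inj[/val_odescs[ho so]].
  by case: a => // b k _; exists l, b, k; split=> //; rewrite -so.
move=> [hP [ss [h1 h2 [l' [b [k [-> ho sl]]]]]]].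
(* Over the integers, [tin < b + k] is [tin + (1 - k) <= b]. *)
apply: (def_ext _ (def_bval_le d BIn (1 - k) b)) => x e _ _ _.
have -> : bval x BIn = x.1.2 by [].
have [os so Eo] := odescs_val x e ho; rewrite map_rcons Eo; split=> [h|].
  split=> //; exists ss; split=> //; exists os, (bval x b + k)%Z; split=> //; [by rewrite so|lia].
by move=> [_ [ss' [_ _ [os' [z [_ /rcons_inj[_ <-]]]]]]]; lia.
Qed.

Lemma def_edb_future d P l : List.Forall (desc_ok d) l ->
  def d (fun x e => edb_future x P (map (val x e) l)).
Proof. by move=> hl; apply: def_or; [exact: def_edb_data | exact: def_future]. Qed.

(** All positions without an object denote [star]; hence two positions agree iff neither carries an
    object or both carry the same code. *)
Lemma def_val_eq d a b : desc_ok d a -> desc_ok d b ->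
  def d (fun x e => val x e a = val x e b).
Proof.
pose rank a := match a with DConst _ => 0 | DPos _ => 1 | DTime _ _ => 2 end.
wlog: a b / rank a <= rank b.
  move=> h ha hb; case/orP: (leq_total (rank a) (rank b)) => ab; first exact: h.
  by apply: (def_ext _ (h b a ab hb ha)) => x e _ _ _; split.
rewrite {}/rank.
case: a b => [c|i|b k] [c'|j|b' k'] //= _ ha hb.
- by apply: (def_ext _ (def_const _ _ d (c = c'))) => x e _ _ _; split=> [->|[]].
- apply: (def_ext (R := fun x e => exists q, q < len x /\ seg (word x) (enc_nat c) (nth 0 e j) q));
    last by fo.
  move=> x e _ he hw; have jx : nth 0 e j < len x by apply: hw; rewrite he.
  split=> [[q [_ /objat_seg ->]] //|[E]].
  have [|q hq] := @objat_spec x (nth 0 e j).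
    by apply: NNPP => /(objat_star jx); rewrite -E; apply: star_const.
  by exists q; rewrite E; split=> //; case: hq.
- by apply: (def_ext _ (def_const _ _ d False)) => x e _ _ _; split.
- apply: (def_ext (R := fun x e => (~ objpos x (nth 0 e i) /\ ~ objpos x (nth 0 e j)) \/
    exists q, q < len x /\ (objpos x (nth 0 e i) /\
      seg (word x) (enc_nat (objat x (nth 0 e i))) (nth 0 e j) q))).
    move=> x e _ he hw; have ix : nth 0 e i < len x by apply: hw; rewrite he.
    have jx : nth 0 e j < len x by apply: hw; rewrite he.
    split=> [[[/(objat_star ix) -> /(objat_star jx) ->]|[q [_ [_ /objat_seg ->]]]] //|[E]].
    case: (classic (objpos x (nth 0 e i))) => hi; last first.
      by left; split=> //; apply/(objat_star jx); rewrite -E; apply/(objat_star ix).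
    have hj : objpos x (nth 0 e j).
      by apply: NNPP => /(objat_star jx); rewrite -E => /(objat_star ix).
    have [q hq] := objat_spec hj.
    by right; exists q; split; [case: hq|rewrite E].
  apply: def_or; first by fo.
  apply: def_ex.
  apply: (def_ext _ (@def_seg_objat d.+1 (fun e => nth 0 e i) (fun e => nth 0 e j)
     (fun e => nth 0 e d) _ _ _)); try proj.
  by move=> x e _ _ _; rewrite !nth_take.
- by apply: (def_ext _ (def_const _ _ d False)) => x e _ _ _; split.
- apply: (def_ext _ (def_bval_eq d b k b' k')) => x e _ _ _.
  by split=> [->|[]].
Qed.

End Descriptors.

(** * Derivations of bounded height *)

Definition interp := Defs.pred -> seq (nat + Z) -> Prop.

Definition eval (ov : nat -> nat) (tv : nat -> Z) (t : term) : nat + Z :=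
  eval_term (U := nat) id ov tv t.

(* [stage Pi E A n] holds the atoms with a derivation of height at most [n] from
   the facts [E], where object variables range over [A]. *)
Fixpoint stage (Pi : program) (E : interp) (A : nat -> Prop) (n : nat) : interp :=
  fun P vs =>
  if n is n'.+1 then
    E P vs \/ exists r, List.In r Pi /\ exists ov tv,
      [/\ forall v, A (ov v), apred (rhead r) = P,
          map (eval ov tv) (aargs (rhead r)) = vs &
          List.Forall (fun b => stage Pi E A n' (apred b) (map (eval ov tv) (aargs b))) (rbody r)]
  else False.

Definition anyobj (o : nat) : Prop := True.

Lemma stage_sub Pi (E E' : interp) (A A' : nat -> Prop) n :
  (forall P vs, E P vs -> E' P vs) -> (forall o, A o -> A' o) ->
  forall P vs, stage Pi E A n P vs -> stage Pi E' A' n P vs.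
Proof.
move=> hE hA; elim: n => //= n IH P vs [h|[r [hr [ov [tv [h1 h2 h3 h4]]]]]].
  by left; apply: hE.
right; exists r; split=> //; exists ov, tv; split=> //; first by move=> v; apply: hA.
by apply: List.Forall_impl h4 => b; apply: IH.
Qed.

Lemma stage_leq Pi E A n m : n <= m -> forall P vs, stage Pi E A n P vs -> stage Pi E A m P vs.
Proof.
elim: n m => // n IH [|m] //; rewrite ltnS => nm P vs /= [h|[r [hr [ov [tv [h1 h2 h3 h4]]]]]].
  by left.
right; exists r; split=> //; exists ov, tv; split=> //.
by apply: List.Forall_impl h4 => b; apply: IH.
Qed.

Definition const_of (c : nat) (Pi : program) : Prop :=
  exists r, List.In r Pi /\ exists a, List.In a (rhead r :: rbody r) /\ List.In (OConst c) (aargs a).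

Definition vmap (h : nat -> nat) (v : nat + Z) : nat + Z :=
  match v with inl o => inl (h o) | inr z => inr z end.

Lemma vmap_eval h ov tv t : (forall c, t = OConst c -> h c = c) ->
  vmap h (eval ov tv t) = eval (fun v => h (ov v)) tv t.
Proof. by case: t => //= o ->. Qed.

(** A map that fixes the constants of the program commutes with instantiating its rules. It serves
    to push derivations over all objects into a small domain. *)
Lemma stage_hom Pi E (A : nat -> Prop) h :
  (forall c, const_of c Pi -> h c = c) -> (forall o, A (h o)) ->
  (forall P vs, E P vs -> E P (map (vmap h) vs)) ->
  forall n P vs, stage Pi E anyobj n P vs -> stage Pi E A n P (map (vmap h) vs).
Proof.
move=> hc hA hE; elim=> //= n IH P vs [h'|[r [hr [ov [tv [h1 h2 h3 h4]]]]]].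
  by left; apply: hE.
have ev a : List.In a (rhead r :: rbody r) ->
    map (vmap h) (map (eval ov tv) (aargs a)) = map (eval (fun v => h (ov v)) tv) (aargs a).
  move=> ha; rewrite -map_comp; apply: List.map_ext_in => t ht /=.
  by apply: vmap_eval => c E'; apply: hc; exists r; split=> //; exists a; rewrite -E'.
right; exists r; split=> //; exists (fun v => h (ov v)), tv; split=> //.
  by rewrite -h3 ev //; left.
apply/List.Forall_forall => b hb; rewrite -ev; last by right.
by apply: IH; move/List.Forall_forall: h4; apply.
Qed.

(** * Acyclic dependency bounds the height of derivations *)

Definition body_preds (Pi : program) : seq Defs.pred :=
  flatten [seq map apred (rbody r) | r <- Pi].

Lemma in_body_preds Pi r b : List.In r Pi -> List.In b (rbody r) -> List.In (apred b) (body_preds Pi).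
Proof.
elim: Pi => //= r' Pi IH [->|hr] hb; apply/List.in_app_iff.
  by left; apply: List.in_map.
by right; apply: IH.
Qed.

Definition below (Pi : program) (P P' : Defs.pred) : bool :=
  if excluded_middle_informative (clos_trans _ (depends Pi) P P') then true else false.

Lemma belowP Pi P P' : below Pi P P' <-> clos_trans _ (depends Pi) P P'.
Proof. by rewrite /below; case: (excluded_middle_informative _). Qed.

Definition prank (Pi : program) (P : Defs.pred) : nat := count (below Pi P) (body_preds Pi).

Lemma count_lt (T : Type) (p q : T -> bool) (s : seq T) a : (forall b, p b -> q b) ->
  List.In a s -> ~~ p a -> q a -> count p s < count q s.
Proof.
move=> pq; elim: s => //= b s IH [->|ha] npa qa.
  by rewrite (negbTE npa) qa add1n ltnS sub_count.
have := IH ha npa qa; have := pq b; case: (p b) => [->//|_]; case: (q b) => //=; lia.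
Qed.

(** What lies below the body predicate lies below the head predicate; the body predicate itself lies
    below the head predicate but, by acyclicity, not below itself. *)
Lemma prank_lt Pi r b : (forall P, ~ clos_trans _ (depends Pi) P P) ->
  List.In r Pi -> List.In b (rbody r) -> prank Pi (apred b) < prank Pi (apred (rhead r)).
Proof.
move=> acyc hr hb.
have dep : depends Pi (apred (rhead r)) (apred b).
  apply/List.Exists_exists; exists r; split=> //; split=> //.
  by apply/List.Exists_exists; exists b.
apply: (@count_lt _ _ _ _ (apred b)).
- by move=> P /belowP h; apply/belowP; apply: t_trans h; apply: t_step.
- exact: in_body_preds hb.
- by apply/negP => /belowP /acyc.
- by apply/belowP; apply: t_step.
Qed.

Definition height (Pi : program) : nat := (size (body_preds Pi)).+1.

Lemma stage_height Pi E A n P vs : (forall P, ~ clos_trans _ (depends Pi) P P) ->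
  stage Pi E A n P vs -> stage Pi E A (height Pi) P vs.
Proof.
move=> acyc.
suff H : stage Pi E A n P vs -> stage Pi E A (prank Pi P).+1 P vs.
  by move/H; apply: stage_leq; rewrite ltnS count_size.
elim: n P vs => //= n IH P vs [h|[r [hr [ov [tv [h1 h2 h3 h4]]]]]]; first by left.
right; exists r; split=> //; exists ov, tv; split=> //; rewrite -h2.
apply/List.Forall_forall => b hb.
apply: (stage_leq (n := (prank Pi (apred b)).+1)); first exact: prank_lt.
by apply: IH; move/List.Forall_forall: h4; apply.
Qed.

(** * Entailment as derivability of bounded height *)

Definition edb (D : dataset) : interp := fun P vs => List.In (Atom P (map term_of vs)) D.

Lemma ground_eval ov tv args : List.Forall ground_term args ->
  map term_of (map (eval ov tv) args) = args.
Proof. by elim: args => //= t l IH h; inversion h; subst; rewrite IH //; case: (t) H1. Qed.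

Lemma stage_entails Pi D n P vs U (c : obj -> U) I : stage Pi (edb D) anyobj n P vs ->
  sat_program c I (with_data Pi D) ->
  I P (map (fun v => match v with inl o => inl (c o) | inr z => inr z end) vs).
Proof.
set lift := (X in map X _) => hs /List.Forall_forall hI; elim: n P vs hs => //= n IH P vs.
have evl ov tv t : lift (eval ov tv t) = eval_term c (fun v => c (ov v)) tv t by case: t.
case=> [hD|[r [hr [ov [tv [_ <- <- h4]]]]]].
  have : sat_rule c I (fact_rule (Atom P (map term_of vs))).
    by apply: hI; apply/List.in_app_iff; right; apply: (List.in_map fact_rule).
  move=> /(_ (fun=> c 0) (fun=> 0%Z) (List.Forall_nil _)).
  by rewrite /sat_atom /= -map_comp; congr I; apply: eq_map => -[].
have : sat_rule c I r by apply: hI; apply/List.in_app_iff; left.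
move=> /(_ (fun v => c (ov v)) tv); rewrite /sat_atom -map_comp (eq_map (evl ov tv)); apply.
apply: List.Forall_impl h4 => b /IH; by rewrite -map_comp (eq_map (evl ov tv)).
Qed.

(** The Herbrand-style least model. One more rule application reaches stage [height + 1], which
    [stage_height] brings back to [height]. *)
Lemma stage_model Pi D : (forall P, ~ clos_trans _ (depends Pi) P P) ->
  List.Forall (fun a => List.Forall ground_term (aargs a)) D ->
  sat_program (U := nat) id (stage Pi (edb D) anyobj (height Pi)) (with_data Pi D).
Proof.
move=> acyc hD; apply/List.Forall_forall => r /List.in_app_iff[hr|].
  move=> ov tv hb; apply: (stage_height (n := (height Pi).+1)) => //.
  by right; exists r; split=> //; exists ov, tv.
move=> /List.in_map_iff[a [<- ha]] ov tv _; left.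
rewrite /edb (@ground_eval ov tv); first by case: a ha.
by move/List.Forall_forall: hD; apply.
Qed.

Lemma entails_stage Pi D P vs : (forall P, ~ clos_trans _ (depends Pi) P P) ->
  List.Forall (fun a => List.Forall ground_term (aargs a)) D ->
  entails (with_data Pi D) (Atom P (map term_of vs)) <->
  stage Pi (edb D) anyobj (height Pi) P vs.
Proof.
move=> acyc hD; split=> [h|h U c I /(stage_entails h) h' ov tv].
  have := h _ _ _ (stage_model acyc hD) (fun=> 0) (fun=> 0%Z).
  by rewrite /sat_atom /= -map_comp (@eq_map _ _ _ id) ?map_id // => -[].
by rewrite /sat_atom /= -map_comp; move: h'; congr I; apply: eq_map => -[].
Qed.

Definition adom_of (A0 : nat -> Prop) (vs : seq (nat + Z)) : Prop :=
  forall o, List.In (inl o) vs -> A0 o.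

(** Object variables of a head occur in the body, so rules introduce no objects but their
    constants. *)
Lemma stage_safe Pi E A n (A0 : nat -> Prop) : wf_program Pi ->
  (forall c, const_of c Pi -> A0 c) -> (forall P vs, E P vs -> adom_of A0 vs) ->
  forall P vs, stage Pi E A n P vs -> adom_of A0 vs.
Proof.
move=> /List.Forall_forall wf hc hE; elim: n => //= n IH P vs [/hE//|].
move=> [r [hr [ov [tv [_ _ <- h4]]]]] o /List.in_map_iff[t [Et ht]].
case: t Et ht => //= [c|v] [<-] ht.
  by apply: hc; exists r; split=> //; exists (rhead r); split=> //; left.
have [_ [_ [_ [hv _]]]] := wf r hr.
have /List.Exists_exists[b [hb /List.Exists_exists[t [ht' Et]]]] : body_has_ovar v r.
  by apply: hv; apply/List.Exists_exists; exists (OVar v).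
move/List.Forall_forall: h4 => /(_ b hb) /IH; apply.
by apply/List.in_map_iff; exists t; rewrite Et in ht' *.
Qed.

(** * Definability of derivations *)

Lemma In_mem (c : nat) s : List.In c s <-> c \in s.
Proof.
elim: s => //= b s IH; rewrite inE IH eq_sym.
by split=> [[->|->]|/orP[/eqP|]]; rewrite ?eqxx ?orbT; auto.
Qed.

Lemma in_flatten_map (T T' : Type) (f : T -> seq T') s a c :
  List.In a s -> List.In c (f a) -> List.In c (flatten (map f s)).
Proof.
elim: s => //= b s IH [->|ha] hc; apply/List.in_app_iff; [by left|right].
exact: IH.
Qed.

Lemma mem_flatten_map (T : Type) (f : T -> seq nat) s a c :
  List.In a s -> c \in f a -> c \in flatten (map f s).
Proof. by rewrite -!In_mem; apply: in_flatten_map. Qed.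

Definition rule_atoms (r : rule) : seq atom := rhead r :: rbody r.

Definition rule_vars (r : rule) : seq nat :=
  flatten [seq flatten [seq (if t is OVar v then [:: v] else [::]) | t <- aargs a]
          | a <- rule_atoms r].

Lemma in_rule_vars r a v : List.In a (rule_atoms r) -> List.In (OVar v) (aargs a) ->
  v \in rule_vars r.
Proof.
move=> ha hv; apply: (mem_flatten_map (f := fun a => flatten _) ha).
by apply: (mem_flatten_map (f := fun t => if t is OVar v then [:: v] else [::]) hv); rewrite inE.
Qed.

(** The leading 0 provides a default value, [DConst 0], for object variables not yet assigned. *)
Definition prog_consts (Pi : program) : seq nat :=
  0 :: flatten [seq flatten [seq flatten [seq (if t is OConst c then [:: c] else [::])
                                         | t <- aargs a] | a <- rule_atoms r] | r <- Pi].

Lemma in_prog_consts Pi c : const_of c Pi -> c \in prog_consts Pi.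
Proof.
move=> [r [hr [a [ha hc]]]]; rewrite inE; apply/orP; right.
apply: (mem_flatten_map (f := fun r => flatten _) hr).
apply: (mem_flatten_map (f := fun a => flatten _) ha).
by apply: (mem_flatten_map (f := fun t => if t is OConst c then [:: c] else [::]) hc); rewrite inE.
Qed.

Section Derivations.

Notation inst := (dataset * Z * Z)%type.
Notation def := (def enc_instance DTP_instance).
Notation len x := (size (enc_instance x)).

Variable Pi : program.
Hypothesis connPi : List.Forall connected_rule Pi.

Notation consts := (prog_consts Pi).
Notation objat := (objat consts).
Notation val := (val consts).
Notation desc_ok := (desc_ok consts).

Definition dom_obj (x : inst) (o : nat) : Prop :=
  o \in consts \/ exists i, i < len x /\ objat x i = o.

Definition oval (x : inst) (e : seq nat) (a : desc) : nat :=
  match a with DConst c => c | DPos i => objat x (nth 0 e i) | DTime _ _ => 0 end.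

Definition odesc_ok (d : nat) (a : desc) : Prop := desc_ok d a /\ is_odesc a.

(** A whole assignment cannot be quantified by finitely many heads; so the listed variables are
    quantified one by one and the others keep their initial values. *)
Fixpoint exov (x : inst) (vars : seq nat) (B : (nat -> nat) -> Prop) (ov : nat -> nat) : Prop :=
  match vars with
  | [::] => B ov
  | v :: vars => exists o, dom_obj x o /\ exov x vars B (upd ov v o)
  end.

Lemma exov_elim x vars B ov : (forall v, dom_obj x (ov v)) -> exov x vars B ov ->
  exists ov', (forall v, dom_obj x (ov' v)) /\ B ov'.
Proof.
elim: vars ov => [|v vars IH] ov hov /= h; first by exists ov.
case: h => o [ho]; apply: IH => u; rewrite /upd; by case: ifP.
Qed.

Lemma exov_intro x vars B ov ov0 : (forall v, dom_obj x (ov v)) ->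
  (forall ov', (forall v, v \in vars -> ov' v = ov v) ->
               (forall v, v \notin vars -> ov' v = ov0 v) -> B ov') ->
  exov x vars B ov0.
Proof.
move=> hov; elim: vars ov0 => [|v vars IH] ov0 /= h; first exact: h.
exists (ov v); split=> //; apply: IH => ov' h1 h2; apply: h => u.
- case: (boolP (u \in vars)) => hu; first by move=> _; apply: h1.
  by rewrite inE (negbTE hu) orbF => /eqP uv; rewrite h2 // /upd uv eqxx.
- by rewrite inE negb_or => /andP[uv hu]; rewrite h2 // /upd (negbTE uv).
Qed.

Lemma oval_take d x e a : desc_ok d a -> oval x (take d e) a = oval x e a.
Proof. by case: a => //= i id; rewrite nth_take. Qed.

Lemma vals_take d x e l : List.Forall (desc_ok d) l ->
  map (val x (take d e)) l = map (val x e) l.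
Proof.
move=> hl; apply: List.map_ext_in => b hb; apply: (val_take (d := d)).
by move/List.Forall_forall: hl; apply.
Qed.

(** An object of [dom_obj] is a constant, which gives a finite disjunction, or is named by a
    position, which gives a new head described by [DPos d]. *)
Lemma def_exov (C : inst -> seq (nat + Z) -> (nat -> nat) -> Prop) :
  (forall d l ovd, List.Forall (desc_ok d) l -> (forall v, odesc_ok d (ovd v)) ->
    def d (fun x e => C x (map (val x e) l) (fun v => oval x e (ovd v)))) ->
  forall vars d l ovd, List.Forall (desc_ok d) l -> (forall v, odesc_ok d (ovd v)) ->
    def d (fun x e => exov x vars (C x (map (val x e) l)) (fun v => oval x e (ovd v))).
Proof.
move=> hC; elim=> [|v vars IH] d l ovd hl hov /=; first exact: hC.
apply: (def_ext (R := fun x e =>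
  (exists c, List.In c consts /\ exov x vars (C x (map (val x e) l))
     (upd (fun v => oval x e (ovd v)) v c)) \/
  (exists i, i < len x /\ exov x vars (C x (map (val x e) l))
     (upd (fun v => oval x e (ovd v)) v (objat x i))))).
  move=> x e _ _ _; split=> [[[c [/In_mem hc h]]|[i [ix h]]]|[o [[/In_mem hc|[i [ix <-]]] h]]].
  - by exists c; split=> //; left.
  - by exists (objat x i); split=> //; right; exists i.
  - by left; exists o.
  - by right; exists i.
apply: def_or.
  apply: def_exlist => c /In_mem hc.
  apply: (def_ext _ (IH d l (upd ovd v (DConst c)) hl _)).
    move=> x e _ _ _; suff -> : (fun u => oval x e (upd ovd v (DConst c) u)) =
      upd (fun u => oval x e (ovd u)) v c by [].
    by apply: functional_extensionality => u; rewrite /upd; case: ifP.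
  by move=> u; rewrite /upd; case: ifP.
apply: def_ex.
have hl' : List.Forall (desc_ok d.+1) l.
  by apply: List.Forall_impl hl => a; apply: desc_ok_widen.
apply: (def_ext _ (IH d.+1 l (upd ovd v (DPos d)) hl' _)).
  move=> x e _ _ _; rewrite (vals_take _ _ hl).
  suff -> : (fun u => oval x e (upd ovd v (DPos d) u)) =
      upd (fun u => oval x (take d e) (ovd u)) v (objat x (nth 0 e d)) by [].
  apply: functional_extensionality => u; rewrite /upd; case: ifP => // _.
  by rewrite oval_take //; case: (hov u).
move=> u; rewrite /upd; case: ifP => // _; first by split=> //=.
by case: (hov u) => h1 h2; split=> //; apply: desc_ok_widen h1.
Qed.

Lemma def_vals_eq d l l' : List.Forall (desc_ok d) l -> List.Forall (desc_ok d) l' ->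
  def d (fun x e => map (val x e) l = map (val x e) l').
Proof.
elim: l l' => [|a l IH] [|b l'] hl hl'.
- by apply: (def_ext _ (def_const _ _ d True)) => x e _ _ _; split.
- by apply: (def_ext _ (def_const _ _ d False)) => x e _ _ _; split.
- by apply: (def_ext _ (def_const _ _ d False)) => x e _ _ _; split.
have [ha {}hl] : desc_ok d a /\ List.Forall (desc_ok d) l by inversion hl.
have [hb {}hl'] : desc_ok d b /\ List.Forall (desc_ok d) l' by inversion hl'.
apply: (def_ext _ (def_and (def_val_eq ha hb) (IH l' hl hl'))).
by move=> x e _ _ _ /=; split=> [[-> ->]|[]].
Qed.

Lemma def_Forall d (T : Type) (s : seq T) (R : T -> inst -> seq nat -> Prop) :
  (forall t, List.In t s -> def d (R t)) ->
  def d (fun x e => List.Forall (fun t => R t x e) s).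
Proof.
elim: s => [|a s IH] h.
  by apply: (def_ext _ (def_const _ _ d True)) => x e _ _ _; split.
apply: (def_ext _ (def_and (h a _) (IH _))); last by move=> t ht; apply: h; right.
  by move=> x e _ _ _; split=> [[h1 h2]|h1]; [constructor|inversion h1].
by left.
Qed.

(* The descriptor of a term, when object variables are described by [ovd] and
   every time variable stands for [bval x b + k]. *)
Definition tdesc (ovd : nat -> desc) (bk : tbase * Z) (t : term) : desc :=
  match t with
  | OConst c => DConst c
  | OVar v => ovd v
  | TConst z => DTime BZero z
  | TVar _ k' => DTime bk.1 (bk.2 + k')
  end.

Definition bkval (x : inst) (bk : tbase * Z) : Z := (bval x bk.1 + bk.2)%Z.

Lemma val_tdesc d x e ovd bk t : (forall v, odesc_ok d (ovd v)) ->
  val x e (tdesc ovd bk t) = eval (fun v => oval x e (ovd v)) (fun=> bkval x bk) t.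
Proof.
move=> h; case: t => //= [v|v k]; last by rewrite /bkval; congr inr; lia.
by have [] := h v; case: (ovd v).
Qed.

Lemma tdesc_ok d r a ovd bk t : List.In r Pi -> List.In a (rule_atoms r) ->
  List.In t (aargs a) -> (forall v, odesc_ok d (ovd v)) -> desc_ok d (tdesc ovd bk t).
Proof.
move=> hr ha ht hov; case: t ht => //= [c|v] ht; last by case: (hov v).
by apply: in_prog_consts; exists r; split=> //; exists a.
Qed.

Lemma tdescs_ok d r a ovd bk : List.In r Pi -> List.In a (rule_atoms r) ->
  (forall v, odesc_ok d (ovd v)) -> List.Forall (desc_ok d) (map (tdesc ovd bk) (aargs a)).
Proof.
move=> hr ha hov; apply/List.Forall_forall => b /List.in_map_iff[t [<- ht]].
exact: tdesc_ok hr ha ht hov.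
Qed.

Lemma vals_tdesc d x e ovd bk ts : (forall v, odesc_ok d (ovd v)) ->
  map (val x e) (map (tdesc ovd bk) ts) = map (eval (fun v => oval x e (ovd v)) (fun=> bkval x bk)) ts.
Proof. by move=> h; rewrite -map_comp; apply: eq_map => t /=; rewrite (val_tdesc _ _ _ _ h). Qed.

(* Since rules are connected, matching the head against descriptors fixes the
   value of the time variable. *)
Definition time_candidates (l : seq desc) (ts : seq term) : seq (tbase * Z) :=
  (BZero, 0%Z) :: flatten [seq flatten [seq
     (match a, t with DTime b k, TVar _ k' => [:: (b, (k - k')%Z)] | _, _ => [::] end)
     | t <- ts] | a <- l].

Lemma eval_map_in ov tv ts (l : seq desc) x e t : map (eval ov tv) ts = map (val x e) l ->
  List.In t ts -> exists2 a, List.In a l & eval ov tv t = val x e a.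
Proof.
elim: ts l => //= t' ts IH [|a l] //= [E1 E2] [<-|ht]; first by exists a; [left|].
by have [b hb E] := IH l E2 ht; exists b; [right|].
Qed.

Lemma candidate_exists r ov tv l x e : List.In r Pi ->
  map (eval ov tv) (aargs (rhead r)) = map (val x e) l ->
  exists2 bk, List.In bk (time_candidates l (aargs (rhead r))) &
    forall a, List.In a (rule_atoms r) -> forall ov',
      map (eval ov' tv) (aargs a) = map (eval ov' (fun=> bkval x bk)) (aargs a).
Proof.
move=> hr E; move/List.Forall_forall: connPi => /(_ r hr) [uniqv headv].
have atomv a v k : List.In a (rule_atoms r) -> List.In (TVar v k) (aargs a) -> rule_has_tvar v r.
  move=> ha hv; have hav : atom_has_tvar v a.
    by apply/List.Exists_exists; exists (TVar v k); split=> //; exists k.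
  move: hav; case: ha => [<-|ha] hav; [by left|right].
  by apply/List.Exists_exists; exists a.
case: (classic (exists v, rule_has_tvar v r)) => [[v hv]|no]; last first.
  (* Without a time variable any value will do; this is the role of the dummy candidate. *)
  exists (BZero, 0%Z); first by left.
  move=> a ha ov'; apply: List.map_ext_in => -[c|u|z|u k] // hu.
  by case: no; exists u; apply: atomv ha hu.
have /List.Exists_exists[t [ht [k' Et]]] : atom_has_tvar v (rhead r).
  by case: hv => // /headv.
have [a ha] := eval_map_in E ht; rewrite Et /eval /=.
case: a ha => // b k ha [Ek].
exists (b, k - k')%Z.
  right; apply: (in_flatten_map (f := fun a => flatten _) ha).
  by apply: (in_flatten_map (f := fun t => match t with TVar _ k' => [:: (b, (k - k')%Z)] | _ => [::] end) ht); rewrite Et; left.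
move=> a' ha' ov'; apply: List.map_ext_in => -[c|u|z|u k0] // hu.
rewrite /eval /= (uniqv u v (atomv _ _ _ ha' hu) hv) /bkval /=.
by congr inr; lia.
Qed.

Variable E : inst -> interp.
Hypothesis def_E : forall d P l, List.Forall (desc_ok d) l ->
  def d (fun x e => E x P (map (val x e) l)).

(** Each level of height unfolds into disjunctions over rules and time candidates and quantifiers
    over object variables, after which the body atoms again have descriptors as arguments. [d] and
    [l] stay general because every level adds heads. *)
Lemma def_stage n d P l : List.Forall (desc_ok d) l ->
  def d (fun x e => stage Pi (E x) (dom_obj x) n P (map (val x e) l)).
Proof.
elim: n d P l => [|n IH] d P l hl; first exact: def_const.
apply: def_or; first exact: def_E.
apply: def_exlist => r hr.
pose C bk (x : inst) vs ov :=
  map (eval ov (fun=> bkval x bk)) (aargs (rhead r)) = vs /\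
  List.Forall (fun b => stage Pi (E x) (dom_obj x) n (apred b)
     (map (eval ov (fun=> bkval x bk)) (aargs b))) (rbody r).
(* [exov] sets only the variables of the rule, so the matrix must not depend on the others. *)
have C_ext bk x vs ov ov' : (forall v, v \in rule_vars r -> ov v = ov' v) ->
    C bk x vs ov -> C bk x vs ov'.
  move=> h; have ev a : List.In a (rule_atoms r) ->
    map (eval ov (fun=> bkval x bk)) (aargs a) = map (eval ov' (fun=> bkval x bk)) (aargs a).
    move=> ha; apply: List.map_ext_in => -[c|u|z|u k0] // hu.
    by rewrite /eval /= h // (in_rule_vars ha hu).
  case=> h1 h2; split; first by rewrite -ev //; left.
  by apply/List.Forall_forall => b hb; rewrite -ev; [move/List.Forall_forall: h2; apply|right].
apply: (def_ext (R := fun x e => apred (rhead r) = P /\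
  exists bk, List.In bk (time_candidates l (aargs (rhead r))) /\
    exov x (rule_vars r) (C bk x (map (val x e) l)) (fun v => oval x e (DConst 0)))).
  move=> x e _ _ _; split.
    move=> [hP [bk [_]]] /exov_elim[|ov [hov [h1 h2]]].
      by move=> v; left; rewrite inE.
    by exists ov, (fun=> bkval x bk).
  move=> [ov [tv [h1 h2 h3 h4]]]; split=> //.
  have [bk hbk ev] := candidate_exists hr h3.
  exists bk; split=> //; apply: (exov_intro h1) => ov' ho _.
  apply: (C_ext _ _ _ ov); first by move=> v hv; rewrite ho.
  split; first by rewrite -ev //; left.
  by apply/List.Forall_forall => b hb; rewrite -ev; [move/List.Forall_forall: h4; apply|right].
apply: def_and; first exact: def_const.
apply: def_exlist => bk _.
apply: (@def_exov (C bk) _ (rule_vars r) d l (fun=> DConst 0) hl _); last first.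
  by move=> v; split=> //; rewrite /= inE.
move=> d' l' ovd hl' hov {d l hl}; apply: def_and.
  apply: (def_ext _ (@def_vals_eq d' (map (tdesc ovd bk) (aargs (rhead r))) l' _ hl')).
    by move=> x e _ _ _; rewrite (vals_tdesc _ _ _ _ hov).
  by apply: (tdescs_ok _ hr) => //; left.
apply: def_Forall => b hb.
apply: (def_ext _ (IH d' (apred b) (map (tdesc ovd bk) (aargs b)) _)).
  by move=> x e _ _ _; rewrite (vals_tdesc _ _ _ _ hov).
by apply: (tdescs_ok _ hr) => //; right.
Qed.

End Derivations.

(** * Reduction to derivations over the input *)

Lemma all2_rcons (S T : Type) (r : S -> T -> bool) s t a b :
  all2 r (rcons s a) (rcons t b) = all2 r s t && r a b.
Proof.
elim: s t => [|c s IH] [|e t] //=; rewrite ?andbT ?andbF //; last by rewrite IH andbA.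
- by case: t; rewrite /= andbF.
- by case: s {IH}; rewrite /= andbF.
Qed.

Lemma future_update x P vs : future x P vs -> update x.1.2 [:: Atom P (map term_of vs)].
Proof.
move=> [hP [ss [hs ho [os [z [so -> hz]]]]]].
have tP : temporal_pred P by exists ss.
have hw : all2 term_has_sort (map term_of (map inl os)) ss.
  by elim: os ss so ho {hs} => [|o os IH] [|[] ss] //= [so] ho; apply: IH.
have hg : List.Forall ground_term (map term_of (rcons (map inl os) (inr z))).
  by apply/List.Forall_forall => t /List.in_map_iff[[o|z'] [<- _]].
split; constructor; try by constructor.
- split=> //; split=> //; split; last by right.
  by rewrite /wf_atom /= hs map_rcons all2_rcons hw.
- by split=> //; exists (map term_of (map inl os)), z; rewrite /= map_rcons.
Qed.

Lemma update_future x P vs U : update x.1.2 U -> List.In (Atom P (map term_of vs)) U ->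
  future x P vs.
Proof.
move=> [/List.Forall_forall h1 /List.Forall_forall h2] hin.
have [[[hw _] _] hP] := h1 _ hin; have [[ss [hs ho]] [os' [z [E hz]]]] := h2 _ hin.
rewrite /= in hP hs; split=> //; exists ss; split=> //; move: hw E; rewrite /wf_atom /= hs.
case/lastP: vs {hin hP} => [|vs v]; first by case: (os').
rewrite map_rcons all2_rcons => /andP[hw _] /rcons_inj[_ hv].
have [os so ->] : exists2 os, size os = size ss & vs = map inl os.
  elim: vs ss hw ho {hs} => [|w vs IH] [|[] ss] //=; first by exists [::].
  by case: w => // o hw ho; have [os so ->] := IH ss hw ho; exists (o :: os); rewrite /= ?so.
by exists os, z; split=> //; case: v hv => // z' [->].
Qed.

Lemma edb_sub D D' P vs : (forall a, List.In a D -> List.In a D') -> edb D P vs -> edb D' P vs.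
Proof. by move=> h; apply: h. Qed.

Lemma update_cat tin U U' : update tin U -> update tin U' -> update tin (U ++ U').
Proof. by move=> [h1 h2] [h3 h4]; split; apply/List.Forall_app. Qed.

(* A derivation uses finitely many of the possible future facts. *)
Lemma stage_compact Pi x n P vs : stage Pi (edb_future x) anyobj n P vs ->
  exists2 U, update x.1.2 U & stage Pi (edb (x.1.1 ++ U)) anyobj n P vs.
Proof.
elim: n P vs => //= n IH P vs [[h|h]|[r [hr [ov [tv [h1 h2 h3 h4]]]]]].
- exists [::]; first by split; constructor.
  by left; rewrite /edb cats0.
- exists [:: Atom P (map term_of vs)]; first exact: future_update.
  by left; apply/List.in_app_iff; right; left.
suff [U hU h5] : exists2 U, update x.1.2 U & List.Forall
    (fun b => stage Pi (edb (x.1.1 ++ U)) anyobj n (apred b) (map (eval ov tv) (aargs b))) (rbody r).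
  by exists U => //; right; exists r; split=> //; exists ov, tv.
elim: h4 => {r hr h2 h3} [|b bs hb _ [U hU hbs]]; first by exists [::]; [split|]; constructor.
have [U' hU' hb'] := IH _ _ hb.
exists (U' ++ U); first exact: update_cat.
constructor.
  apply: stage_sub hb' => // Q ws; apply: edb_sub => a.
  by rewrite !List.in_app_iff; tauto.
apply: List.Forall_impl hbs => c; apply: stage_sub => // Q ws; apply: edb_sub => a.
by rewrite !List.in_app_iff; tauto.
Qed.

Section Reduction.

Variable Q : query.
Hypothesis wfQ : wf_query Q.
Hypothesis nonrecQ : nonrecursive Q.
Hypothesis connQ : connected Q.

Notation inst := (dataset * Z * Z)%type.
Notation len x := (size (enc_instance x)).
Notation Pi := (qprog Q).
Notation N := (height (qprog Q)).
Notation consts := (prog_consts (qprog Q)).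
Notation objat := (objat consts).
Notation star := (star consts).
Notation dom_obj := (dom_obj Pi).

Definition goal_args (os : seq nat) (t : Z) : seq (nat + Z) := rcons (map inl os) (inr t).

Definition arity : nat := (size (psorts (qpred Q))).-1.

Lemma answer_stage D t os : is_dataset D ->
  answer Q D t os <->
  size os = arity /\ stage Pi (edb D) anyobj N (qpred Q) (goal_args os t).
Proof.
move=> /List.Forall_forall hD; rewrite -entails_stage //; last first.
  by apply/List.Forall_forall => a /hD[[]].
by rewrite /goal_args map_rcons -map_comp.
Qed.

(** Derivability is monotone in the facts, so DTP can fail only by gaining answers. Every update
    lies within the future facts, and by compactness a derivation from these needs only an
    update. *)
Lemma dtp_future x : DTP_instance x -> DTP_holds Q x <->
  forall os, size os = arity ->
    stage Pi (edb_future x) anyobj N (qpred Q) (goal_args os x.2) ->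
    stage Pi (edb x.1.1) anyobj N (qpred Q) (goal_args os x.2).
Proof.
case: x => -[D tin] tout [[hD _] _]; split=> [h os so|h U hU os].
  move/stage_compact => [U hU /= hs].
  have hDU : is_dataset (D ++ U) by apply/List.Forall_app; split=> //; case: hU.
  have := (h U hU os).2; rewrite !answer_stage // => h'.
  by case: h'.
have hDU : is_dataset (D ++ U) by apply/List.Forall_app; split=> //; case: hU.
rewrite !answer_stage //; split=> -[so hs]; split=> //.
  apply: stage_sub hs => // P vs; apply: edb_sub => a ha.
  by apply/List.in_app_iff; left.
apply: h => //; apply: stage_sub hs => // P vs /List.in_app_iff[h'|h']; [by left|right].
exact: update_future h'.
Qed.

(* The active domain, whereas [dom_obj] also contains [star]. *)
Definition active (x : inst) (o : nat) : Prop :=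
  o \in consts \/ exists i, [/\ i < len x, objpos x i & objat x i = o].

Definition collapse (x : inst) (o : nat) : nat :=
  if excluded_middle_informative (active x o) then o else star x.

Lemma collapse_id x o : active x o -> collapse x o = o.
Proof. by rewrite /collapse; case: (excluded_middle_informative _). Qed.

Lemma active_star x : ~ active x (star x).
Proof.
by case=> [/star_const|[i [ix ip /(objat_star _ ix)]]] //; apply.
Qed.

Lemma active_dom x o : active x o -> dom_obj x o.
Proof. by case=> [h|[i [h1 h2 h3]]]; [left|right; exists i]. Qed.

(** The position of [HashS] carries no object, so some position always denotes [star]. *)
Lemma star_dom x : DTP_instance x -> dom_obj x (star x).
Proof.
move=> hx; pose h := size (enc_dataset x.1.1).
have hl : h < len x by rewrite /h; case: (x) => -[D tin] tout; rewrite /enc_instance !size_cat /=; lia.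
right; exists h; split=> //; apply/(objat_star _ hl) => -[o [q [_ _ sg]]].
have [u [hu _] Eu] := enc_natE o.
have := sg 0; rewrite addn0 (hash_pos hl).2 // Eu size_rcons => /(_ isT).
by case: (u) hu => [//|a v] /= /andP[/orP[]/eqP ->].
Qed.

Lemma dom_collapse x o : DTP_instance x -> dom_obj x (collapse x o).
Proof.
move=> hx; rewrite /collapse; case: (excluded_middle_informative _) => h.
  exact: active_dom.
exact: star_dom.
Qed.

Lemma dom_collapse_id x o : dom_obj x o -> collapse x o = o.
Proof.
rewrite /collapse; case: (excluded_middle_informative _) => //= h hd.
case: hd => [hc|[i [ix E]]]; first by case: h; left.
rewrite -E; symmetry; apply/(objat_star _ ix) => hp.
by apply: h; right; exists i.
Qed.

Lemma collapse_active x o : active x (collapse x o) -> collapse x o = o.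
Proof.
rewrite /collapse; case: (excluded_middle_informative _) => //= h.
by move/active_star.
Qed.

Lemma edb_active x P vs : edb x.1.1 P vs -> adom_of (active x) vs.
Proof.
move=> h o ho; right; apply: (data_objpos _ h).
by apply/List.in_map_iff; exists (inl o).
Qed.

Lemma vmap_collapse_id x vs : adom_of (active x) vs -> map (vmap (collapse x)) vs = vs.
Proof.
elim: vs => //= v vs IH h; rewrite IH; last by move=> o ho; apply: h; right.
by case: v h => //= o h; rewrite collapse_id //; apply: h; left.
Qed.

Lemma edb_collapse x P vs : edb x.1.1 P vs -> edb x.1.1 P (map (vmap (collapse x)) vs).
Proof. by move=> h; rewrite vmap_collapse_id //; apply: edb_active h. Qed.

(** Future facts are unrestricted in their objects, and those of the data contain active objects
    only, which [collapse] fixes. *)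
Lemma future_collapse x P vs :
  edb_future x P vs -> edb_future x P (map (vmap (collapse x)) vs).
Proof.
case=> [h|[hP [ss [h1 h2 [os [z [so -> hz]]]]]]]; first by left; apply: edb_collapse.
right; split=> //; exists ss; split=> //; exists (map (collapse x) os), z; split=> //.
  by rewrite size_map.
by rewrite map_rcons -!map_comp.
Qed.

Lemma stage_collapse x (E : interp) n P vs : DTP_instance x ->
  (forall P vs, E P vs -> E P (map (vmap (collapse x)) vs)) ->
  stage Pi E anyobj n P vs -> stage Pi E (dom_obj x) n P (map (vmap (collapse x)) vs).
Proof.
move=> hx hE; apply: stage_hom => // [c hc|o]; last exact: dom_collapse.
by apply: collapse_id; left; apply: in_prog_consts.
Qed.

Lemma goal_collapse x os t :
  map (vmap (collapse x)) (goal_args os t) = goal_args (map (collapse x) os) t.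
Proof. by rewrite /goal_args map_rcons -!map_comp. Qed.

(* Collapsing all inactive objects to one shows that it suffices to consider the
   objects written in the input, the constants of the query and [star]. *)
Lemma dtp_dom x : DTP_instance x -> DTP_holds Q x <->
  forall ov, (forall v, dom_obj x (ov v)) ->
    stage Pi (edb_future x) (dom_obj x) N (qpred Q) (goal_args (map ov (iota 0 arity)) x.2) ->
    stage Pi (edb x.1.1) (dom_obj x) N (qpred Q) (goal_args (map ov (iota 0 arity)) x.2).
Proof.
move=> hx; rewrite dtp_future //; split=> h.
  move=> ov hov hs.
  have {hs} : stage Pi (edb x.1.1) anyobj N (qpred Q) (goal_args (map ov (iota 0 arity)) x.2).
    by apply: h; [rewrite size_map size_iota | apply: stage_sub hs].
  move/(stage_collapse hx (@edb_collapse x)); rewrite goal_collapse -map_comp.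
  by rewrite (@eq_map _ _ _ ov) // => v /=; rewrite dom_collapse_id.
move=> os so /(stage_collapse hx (@future_collapse x)); rewrite goal_collapse.
pose ov v := collapse x (nth 0 os v).
have -> : map (collapse x) os = map ov (iota 0 arity).
  by rewrite -{1}(mkseq_nth 0 os) so -map_comp.
move/(h ov (fun v => dom_collapse _ hx)) => hs.
(* The collapsed tuple is derived from the data alone, so its objects are active; as [star] is not,
   collapsing has changed nothing. *)
suff E : map ov (iota 0 arity) = os.
  by rewrite E in hs; apply: stage_sub hs.
have hact := stage_safe wfQ.1 (A0 := active x) _ (@edb_active x) hs.
transitivity (mkseq (nth 0 os) (size os)); last exact: mkseq_nth.
rewrite so; apply: List.map_ext_in => v hv.
apply: collapse_active; apply: hact.
  by move=> c hc; left; apply: in_prog_consts.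
rewrite /goal_args -cats1; apply/List.in_app_iff; left.
by apply: List.in_map; apply/List.in_map_iff; exists v.
Qed.

Lemma def_dtp : def enc_instance DTP_instance 0 (fun x _ => DTP_holds Q x).
Proof.
pose C (x : inst) (vs : seq (nat + Z)) ov :=
  stage Pi (edb_future x) (dom_obj x) N (qpred Q) (goal_args (map ov (iota 0 arity)) (bval x BOut + 0)) /\
  ~ stage Pi (edb_data x) (dom_obj x) N (qpred Q) (goal_args (map ov (iota 0 arity)) (bval x BOut + 0)).
apply: (def_ext (R := fun x e => ~ exov Pi x (iota 0 arity) (C x [::])
                                  (fun v => oval Pi x e (DConst 0)))).
  move=> x e hx _ _; rewrite dtp_dom //.
  (* This is the form in which [DTime BOut 0], the descriptor of the goal time, evaluates. *)
  have -> : x.2 = (bval x BOut + 0)%Z by rewrite /=; lia.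
  split=> [h ov hov hs|h /exov_elim[|ov [hov [h1 h2]]]].
  - apply: NNPP => ns; apply: h; apply: (exov_intro hov) => ov' E _.
    have -> : C x [::] ov' = C x [::] ov.
      by rewrite /C (@eq_in_map _ _ ov' ov _).1.
    by split.
  - by move=> v; left; rewrite inE.
  - by apply: h2; apply: h.
apply: def_not.
apply: (@def_exov Pi C _ (iota 0 arity) 0 [::] (fun=> DConst 0) _ _);
  [|by constructor|by move=> v; split; rewrite //= inE].
move=> d l ovd _ hov.
pose l' := rcons (map ovd (iota 0 arity)) (DTime BOut 0).
have hl' : List.Forall (desc_ok consts d) l'.
  rewrite /l' -cats1; apply/List.Forall_app; split; last by constructor.
  by apply/List.Forall_forall => a /List.in_map_iff[v [<- _]]; case: (hov v).
have El' x e : map (val consts x e) l' =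
    goal_args (map (fun v => oval Pi x e (ovd v)) (iota 0 arity)) (bval x BOut + 0).
  rewrite /l' /goal_args map_rcons -!map_comp; congr rcons.
  by apply: eq_map => v /=; have [] := hov v; case: (ovd v).
apply: def_and.
  apply: (def_ext _ (def_stage connQ (E := edb_future) _ N (qpred Q) hl')).
    by move=> x e _ _ _; rewrite El'.
  by move=> *; apply: def_edb_future.
apply: def_not; apply: (def_ext _ (def_stage connQ (E := edb_data) _ N (qpred Q) hl')).
  by move=> x e _ _ _; rewrite El'.
by move=> *; apply: def_edb_data.
Qed.

End Reduction.

(* Data complexity: for every fixed nonrecursive connected temporal query Q,
   DTP for Q is decided by a polynomial-time Turing machine, with time points
   encoded in unary. *)
Theorem theorem6 :
  forall Q : query,
    wf_query Q -> temporal_query Q -> nonrecursive Q -> connected Q ->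
    exists M : TM, ptime_decides M enc_instance DTP_instance (DTP_holds Q).
Proof.
move=> Q wfQ _ nonrecQ connQ.
exact: (def_ptime enc_instance_gt0 (def_dtp wfQ nonrecQ connQ)).
Qed.
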